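(* There are precisely sixteen $\mathbb{Z}[\sqrt2]$-points on the curve $V(2+\sqrt2)_{0,3}$. With $w=\sqrt2$ and $u=1+w$, they are the points $\pm(a_1,a_2,a_3)$ with $(a_1,a_2,a_3)$ one of the following eight triples: $$(3-w,\ 1+w=u,\ 3-2w),$$ $$(1+w,\ -1-w=-u,\ 1),$$ $$(1+w,\ -1+w=u^{-1},\ -1),$$ $$(3+3w,\ 1-w=-u^{-1},\ 1+2w),$$ $$(57-39w,\ 239+169w=u^7,\ -73+52w),$$ $$(-421+299w,\ -239-169w=-u^7,\ -551+390w),$$ $$(203+143w,\ -239+169w=u^{-7},\ -109-78w),$$ $$(681+481w,\ 239-169w=-u^{-7},\ 369+260w).$$
   Context: The PCF variety $V(2+\sqrt2)_{0,3}\subseteq\mathbb{A}^3$ is the variety associated with the polynomial $x^2-(2+\sqrt2)$ with roots $\pm\sqrt{2+\sqrt2}$. With $\begin{bmatrix}E_{11}&E_{12}\\ E_{21}&E_{22}\end{bmatrix}=D(x_1)D(x_2)D(x_3)$, $D(c)=\begin{bmatrix}c&1\\1&0\end{bmatrix}$, it is defined by $A(E_{22}-E_{11})=BE_{21}$, $-AE_{12}=CE_{21}$, $-BE_{12}=C(E_{22}-E_{11})$ for $(A,B,C)=(1,0,-(2+\sqrt2))$; explicitly, by $$x_2-x_1x_2x_3-x_1-x_3=0,\qquad x_1x_2+1=(2+\sqrt2)(x_2x_3+1).$$ *)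

(* Defs.v *)
From HB Require Import structures.
From mathcomp Require Import all_boot all_order all_algebra all_field.
Set Implicit Arguments. Unset Strict Implicit. Unset Printing Implicit Defensive.
Import Order.TTheory GRing.Theory Num.Theory.
Local Open Scope ring_scope.

Definition pcfD (R : comNzRingType) (c : R) : 'M[R]_2 :=
  \matrix_(i, j) (nth [::] [:: [:: c; 1]; [:: 1; 0]] i)`_j.

(* The R-points of the PCF variety V_{0,3} of A X^2 + B X + C; the paper's
   indices 1, 2 of the entries of E are 0, 1 here. *)
Definition pcf_variety03 (R : comNzRingType) (A B C : R) (P : R * R * R) : Prop :=
  let: (x1, x2, x3) := P in
  let E := pcfD x1 *m pcfD x2 *m pcfD x3 in
  [/\ A * (E 1 1 - E 0 0) = B * E 1 0,
      - (A * E 0 1) = C * E 1 0 &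
      - (B * E 0 1) = C * (E 1 1 - E 0 0)].

Lemma pcf_variety03E (R : comNzRingType) (b x1 x2 x3 : R) :
  pcf_variety03 1 0 (- b) (x1, x2, x3) <->
  x2 - x1 * x2 * x3 - x1 - x3 = 0 /\ x1 * x2 + 1 = b * (x2 * x3 + 1).
Proof.
rewrite /pcf_variety03 !mxE !big_ord_recl !big_ord0 !mxE /=.
rewrite !big_ord_recl !big_ord0 !mxE /= !(mul1r, mulr1, mul0r, mulr0, addr0, oppr0).
rewrite !mulNr.
have -> : x2 - ((x1 * x2 + 1) * x3 + x1) = x2 - x1 * x2 * x3 - x1 - x3.
  by rewrite mulrDl mul1r !opprD !addrA addrAC.
split=> [[h1 /oppr_inj h2 _]|[h1 h2]]; first by split.
by split; rewrite ?h1 ?h2 ?mulr0 ?oppr0.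
Qed.

(* The subring Z[sqrt 2] of the field of algebraic numbers; sqrtC 2 is the
   positive square root. *)
Definition in_Zsqrt2 (x : algC) : Prop :=
  exists a b : int, x = a%:~R + b%:~R * sqrtC 2.

Definition Zsqrt2_triple (P : algC * algC * algC) : Prop :=
  [/\ in_Zsqrt2 P.1.1, in_Zsqrt2 P.1.2 & in_Zsqrt2 P.2].

(* Main.v *)
(* Eliminating x1 and x3, the coordinate y = x2 is a unit a + b sqrt 2 and
   z = x2 x3 + 1 satisfies (2 + sqrt 2) z^2 = y^2 + 1.  Norms exclude N y = 1, and for
   N y = -1 they force |b| = g^2, whence Ljunggren's equation a^2 + 1 = 2 g^4.

   Solving two Pythagorean equations gives g = |beta|^2 for a Gaussian integer beta such
   that (1 + i) beta^4 has imaginary part 1 or -1.  So beta / conj beta is within O(g^-2)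
   of a fixed 16th root of unity, up to units.  The same holds for beta0 = 3 + 2 i (which
   comes from 239^2 + 1 = 2 * 13^4), and the Pade approximants t B(t^4) - A(t^4) of the
   fourth root, evaluated at the ratio for beta0, yield Gaussian integers, of which one in
   two consecutive is not zero, and which are smaller than 1 for a suitable degree if g is
   large; this bounds g by 2^130.  The remaining
   solutions of a^2 + 1 = 2 b^2 form an explicit Pell sequence, which is checked for squares.

   The approximant is N times the divided difference of e |-> t^e at the nodes 4k and
   4k + 1, k <= r.  A divided difference at n + 1 integer nodes is a convex combination of
   those at consecutive nodes, t^m (t - 1)^n / n!, so it is at most |t - 1|^n / n! on the
   unit circle, and no analysis is needed. *)
Require Import Defs.
From Stdlib Require Import NArith.
From HB Require Import structures.
From mathcomp Require Import all_boot all_order all_algebra all_field.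
From mathcomp Require Import zify ring.
Set Implicit Arguments. Unset Strict Implicit. Unset Printing Implicit Defensive.
Import Order.TTheory GRing.Theory Num.Theory.
Local Open Scope ring_scope.

(** * Divided differences of powers *)

Definition node_prod (F : numFieldType) (s : seq nat) (e : nat) : F :=
  \prod_(d <- s | d != e) (e%:R - d%:R).

(** The divided difference of [e |-> 'X^e] at the nodes [s], in Lagrange form. *)
Definition divdiffX (F : numFieldType) (s : seq nat) : {poly F} :=
  \sum_(e <- s) (node_prod F s e)^-1 *: 'X^e.

Lemma perm_node_prod (F : numFieldType) s1 s2 e :
  perm_eq s1 s2 -> node_prod F s1 e = node_prod F s2 e.
Proof. exact: perm_big. Qed.

Lemma perm_divdiffX (F : numFieldType) s1 s2 :
  perm_eq s1 s2 -> divdiffX F s1 = divdiffX F s2.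
Proof.
move=> s12; rewrite /divdiffX (perm_big _ s12) /=.
by apply: eq_bigr => e _; rewrite (perm_node_prod _ _ s12).
Qed.

Lemma subr_nat_neq0 (F : numFieldType) (d e : nat) :
  d != e -> (d%:R - e%:R : F) != 0.
Proof. by rewrite subr_eq0 eqr_nat. Qed.

Lemma node_prod_neq0 (F : numFieldType) s e : node_prod F s e != 0.
Proof.
rewrite prodf_seq_neq0; apply/allP => d _; apply/implyP => de.
by apply: subr_nat_neq0; rewrite eq_sym.
Qed.

Lemma node_prod_cons (F : numFieldType) d s e :
  node_prod F (d :: s) e = (if d == e then 1 else e%:R - d%:R) * node_prod F s e.
Proof. by rewrite /node_prod big_cons; case: eqP => //= _; rewrite mul1r. Qed.

(** Newton's recursion. Coefficient by coefficient it is the partial fraction [(b - a) / ((e - a) *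
    (e - b)) = 1 / (e - b) - 1 / (e - a)]. *)
Lemma divdiffX_cons2 (F : numFieldType) a b s : uniq [:: a, b & s] ->
  (b%:R - a%:R) *: divdiffX F [:: a, b & s] = divdiffX F (b :: s) - divdiffX F (a :: s).
Proof.
rewrite /= inE negb_or => /andP[/andP[ab as_] /andP[bs us]].
have ba := ab; rewrite eq_sym in ba.
have ba' := subr_nat_neq0 F ba; have ab' := subr_nat_neq0 F ab.
rewrite /divdiffX !big_cons !scalerDr !node_prod_cons !eqxx.
rewrite (negPf ab) (negPf ba) !mul1r !scalerA.
have -> : (b%:R - a%:R) / ((a%:R - b%:R) * node_prod F s a) = - (node_prod F s a)^-1.
  by field; rewrite ab' node_prod_neq0.
have -> : (b%:R - a%:R) / ((b%:R - a%:R) * node_prod F s b) = (node_prod F s b)^-1.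
  by field; rewrite ba' node_prod_neq0.
have -> : (b%:R - a%:R) *: (\sum_(e <- s) (node_prod F [:: a, b & s] e)^-1 *: 'X^e) =
  \sum_(e <- s) (node_prod F (b :: s) e)^-1 *: 'X^e
   - \sum_(e <- s) (node_prod F (a :: s) e)^-1 *: 'X^e.
  rewrite scaler_sumr -sumrB; apply: eq_big_seq => e es.
  have ae : a != e by apply: contraNneq as_ => ->.
  have be : b != e by apply: contraNneq bs => ->.
  have ea := ae; rewrite eq_sym in ea; have eb := be; rewrite eq_sym in eb.
  rewrite !node_prod_cons (negPf ae) (negPf be) scalerA -scalerBl; congr (_ *: _).
  by field; rewrite !subr_nat_neq0 ?node_prod_neq0.
by rewrite scaleNr; ring.
Qed.

(** By Newton's recursion the three divided differences differ from one another by multiples of the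
    one at all of [a], [b], [e], [s]. For [a < e < b] this is a convex combination up to the factor
    [b - a]. *)
Lemma divdiffX_insert (F : numFieldType) a b e s : uniq [:: a, b, e & s] ->
  (b%:R - a%:R) *: divdiffX F [:: a, b & s] =
  (e%:R - a%:R) *: divdiffX F [:: a, e & s] + (b%:R - e%:R) *: divdiffX F [:: e, b & s].
Proof.
move=> u; have u' : uniq [:: e, b, a & s].
  rewrite -(@perm_uniq _ [:: a, b, e & s]) //; apply/permP => P /=; lia.
have := divdiffX_cons2 F u; have := divdiffX_cons2 F u'.
rewrite (@perm_divdiffX F [:: b, a & s] [:: a, b & s]); last by apply/permP => P /=; lia.
rewrite (@perm_divdiffX F [:: e, a & s] [:: a, e & s]); last by apply/permP => P /=; lia.
rewrite (@perm_divdiffX F [:: b, e & s] [:: e, b & s]); last by apply/permP => P /=; lia.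
rewrite (@perm_divdiffX F [:: e, b, a & s] [:: a, b, e & s]); last by apply/permP => P /=; lia.
move: (divdiffX _ _) (divdiffX _ _) (divdiffX _ _) (divdiffX _ _) => T Sab Sae Seb.
move=> /(canLR (subrK _)) <- /(canLR (subrK _)) <-.
by rewrite -!mul_polyC !rmorphB /=; ring.
Qed.

(** An algebraic form of [|p(t)| <= v * |t - 1| ^ n] on the unit circle: there the absolute value of
    a polynomial with nonnegative coefficients is at most its value at 1. *)
Definition nneg_quotient (F : numFieldType) (n : nat) (v : F) (p : {poly F}) :=
  exists q : {poly F}, [/\ p = ('X - 1) ^+ n * q, forall i, 0 <= q`_i & q.[1] = v].

Lemma nneg_quotientD (F : numFieldType) n (v1 v2 : F) p1 p2 :
  nneg_quotient n v1 p1 -> nneg_quotient n v2 p2 -> nneg_quotient n (v1 + v2) (p1 + p2).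
Proof.
move=> [q1 [-> q1ge0 <-]] [q2 [-> q2ge0 <-]]; exists (q1 + q2).
by split=> [|i|]; rewrite ?mulrDr ?coefD ?addr_ge0 ?hornerD.
Qed.

Lemma nneg_quotientZ (F : numFieldType) n (c v : F) p :
  0 <= c -> nneg_quotient n v p -> nneg_quotient n (c * v) (c *: p).
Proof.
move=> c0 [q [-> qge0 <-]]; exists (c *: q).
by split=> [|i|]; rewrite ?scalerAr ?coefZ ?mulr_ge0 ?hornerZ.
Qed.

Lemma divdiffX_iota (F : numFieldType) m n :
  divdiffX F (iota m n.+1) = n`!%:R^-1 *: ('X^m * ('X - 1) ^+ n).
Proof.
elim: n m => [|n IHn] m.
  rewrite /divdiffX /= big_seq1 /node_prod big_cons big_nil eqxx /=.
  by rewrite fact0 invr1 !scale1r mulr1.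
(* The recursion is applied to the two extreme nodes, so that dropping either one leaves consecutive
   nodes. *)
have perm1 : perm_eq (iota m n.+2) [:: m, m + n.+1 & iota m.+1 n]%N.
  apply/permP => P; rewrite -(addn1 n.+1) iotaD /= count_cat /=; lia.
have u : uniq [:: m, m + n.+1 & iota m.+1 n]%N.
  by rewrite -(perm_uniq perm1) iota_uniq.
have perm2 : perm_eq ((m + n.+1)%N :: iota m.+1 n) (iota m.+1 n.+1).
  by apply/permP => P; rewrite -(addn1 n) iotaD /= count_cat /= addSnnS addn1; lia.
have nz : ((m + n.+1)%:R - m%:R : F) = n.+1%:R by rewrite natrD addrC addKr.
have n0 : n.+1%:R != 0 :> F by rewrite pnatr_eq0.
apply: (scalerI n0); rewrite -[in LHS]nz (perm_divdiffX F perm1) divdiffX_cons2 //.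
rewrite (perm_divdiffX F perm2) -/(iota m n.+1) !IHn scalerA factS natrM invfM.
rewrite mulrA divff // mul1r -scalerBr; congr (_ *: _).
by rewrite !exprS; ring.
Qed.

(* Inserting a node inside the range of [s] writes the divided difference as a
   convex combination of two with a shorter range, down to consecutive nodes. *)
Lemma divdiffX_nneg_quotient (F : numFieldType) d lo n s :
  uniq s -> size s = n.+1 -> {subset s <= iota lo d} ->
  nneg_quotient n (n`!%:R^-1 : F) (divdiffX F s).
Proof.
elim: d lo s => [|d IHd] lo s us ss sub.
  by case: s ss sub {us} => // x s _ /(_ x); rewrite inE eqxx => /(_ isT).
case: (boolP (all (mem s) (iota lo d.+1))) => [/allP full|/allPn[e]].
  have sE : perm_eq s (iota lo n.+1).
    have sz := uniq_leq_size (iota_uniq lo d.+1) full.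
    have sz' := uniq_leq_size us sub.
    have nd : n = d by rewrite ss !size_iota in sz sz'; lia.
    rewrite nd; apply: uniq_perm => // [|e]; first exact: iota_uniq.
    by apply/idP/idP => [/sub|/full].
  rewrite (perm_divdiffX _ sE) divdiffX_iota -[X in nneg_quotient _ X]mulr1.
  apply: nneg_quotientZ; first by rewrite invr_ge0 ler0n.
  exists 'X^lo; split; rewrite 1?mulrC ?hornerXn ?expr1n // => i.
  by rewrite coefXn ler0n.
rewrite mem_iota => eI /= es.
case: (boolP (lo \in s)) => los; last first.
  apply: (IHd lo.+1 s) => // x xs; have := sub _ xs; rewrite !mem_iota => h.
  have : x != lo by apply: contraNneq los => <-.
  lia.
case: (boolP ((lo + d)%N \in s)) => his; last first.
  apply: (IHd lo s) => // x xs; have := sub _ xs; rewrite !mem_iota => h.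
  have : x != (lo + d)%N by apply: contraNneq his => <-.
  lia.
(* Both ends of the range are nodes and [e] is not, so [e] lies strictly between them. Exchanging
   either end for [e] shortens the range. *)
have elo : e != lo by apply: contraNneq es => ->.
have ehi : e != (lo + d)%N by apply: contraNneq es => ->.
set hi := (lo + d)%N in his ehi.
have [s' sE] : exists s', perm_eq s [:: lo, hi & s'].
  exists (rem hi (rem lo s)); apply: (perm_trans (perm_to_rem los)).
  rewrite perm_cons; apply: perm_to_rem.
  by rewrite mem_rem_uniq // inE his /hi; lia.
have uE : uniq [:: lo, hi, e & s'].
  rewrite (@perm_uniq _ _ (e :: s)) ?cons_uniq ?es //.
  rewrite -[X in perm_eq X _]/([:: lo; hi] ++ (e :: s')) perm_catC /=.
  rewrite perm_cons perm_sym; apply: perm_trans sE _.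
  by rewrite -[X in perm_eq X _]/([:: lo; hi] ++ s') perm_catC.
have ss' : size s' = n.-1 by have := perm_size sE; rewrite ss /=; lia.
have n1 : (0 < n)%N by have := perm_size sE; rewrite ss /=; lia.
have sub' x : x \in s' -> (lo < x < hi)%N.
  move=> xs; have : x \in s by rewrite (perm_mem sE) !inE xs !orbT.
  move/sub; rewrite mem_iota; move: uE; rewrite /= !inE !negb_or.
  case/and4P=> /and3P[_ _ lo_s] /andP[_ hi_s] _ _.
  have : x != lo by apply: contraNneq lo_s => <-.
  have : x != hi by apply: contraNneq hi_s => <-.
  by rewrite /hi; lia.
have c0 : ((hi%:R : F) - lo%:R) != 0 by apply: subr_nat_neq0; rewrite /hi; lia.
rewrite (perm_divdiffX _ sE) -[divdiffX _ _](scalerK c0) (divdiffX_insert F uE).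
rewrite -[X in nneg_quotient _ X](mulKf c0).
apply: nneg_quotientZ.
  by rewrite invr_ge0 subr_ge0 ler_nat /hi; lia.
have -> : (hi%:R - lo%:R) / n`!%:R =
  (e%:R - lo%:R) / n`!%:R + (hi%:R - e%:R) / n`!%:R :> F by ring.
have [lt_lo_e lt_e_hi] : (lo < e)%N /\ (e < hi)%N.
  by split; move: eI elo ehi; rewrite /hi; clear; lia.
move: uE; rewrite /= !inE !negb_or.
case/and4P=> /and3P[lohi loe los'] /andP[hie his'] es' us'.
have size3 : (size s').+2 = n.+1 by rewrite ss'; move: n1; clear; lia.
apply: nneg_quotientD; apply: nneg_quotientZ; rewrite ?subr_ge0 ?ler_nat 1?ltnW //.
  apply: (IHd lo) => [||x]; rewrite /= ?inE ?negb_or ?loe ?los' ?es' //.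
  rewrite mem_iota => /or3P[/eqP->|/eqP->|/sub'];
    by move: lt_lo_e lt_e_hi; rewrite /hi; clear; lia.
apply: (IHd lo.+1) => [||x]; rewrite /= ?inE ?negb_or ?his' ?es' ?[e == hi]eq_sym ?hie //.
rewrite mem_iota => /or3P[/eqP->|/eqP->|/sub'];
  by move: lt_lo_e lt_e_hi; rewrite /hi; clear; lia.
Qed.

(** * Approximants of the fourth root *)

Local Open Scope nat_scope.

(** This is [4 ^ n] times the Pochhammer symbol of [c / 4]. *)
Definition rise4 (c n : nat) : nat := \prod_(j < n) (4 * j + c).

Lemma rise4S c n : rise4 c n.+1 = rise4 c n * (4 * n + c).
Proof. by rewrite /rise4 big_ord_recr. Qed.

Lemma rise4D c m n : rise4 c (m + n) = rise4 c m * rise4 (4 * m + c) n.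
Proof.
elim: n => [|n IHn]; first by rewrite addn0 /rise4 big_ord0 muln1.
by rewrite addnS !rise4S IHn -mulnA; congr (_ * (_ * _)); lia.
Qed.

Lemma rise4_gt0 c n : 0 < c -> 0 < rise4 c n.
Proof. by move=> c0; apply: prodn_gt0 => i; lia. Qed.

Lemma prod_addn_bin x n : \prod_(j < n) (x + j.+1) = 'C(x + n, n) * n`!.
Proof.
rewrite bin_ffact; elim: n => [|n IHn]; first by rewrite big_ord0 ffactn0.
by rewrite big_ord_recr /= IHn addnS ffactSS mulnC.
Qed.

Lemma logn2_fact_le n : logn 2 n`! <= n.
Proof.
rewrite logn_fact //.
(* In Legendre's sum, the leftover [n %/ 2 ^ N] pays for all later terms, since twice
   [n %/ 2 ^ N.+1] is at most [n %/ 2 ^ N]. *)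
suff h N : \sum_(1 <= k < N.+1) n %/ 2 ^ k + n %/ 2 ^ N <= n.
  exact: leq_trans (leq_addr _ _) (h n).
elim: N => [|N IHN]; first by rewrite big_geq // expn0 divn1.
rewrite big_nat_recr //=; apply: leq_trans IHN; rewrite -addnA leq_add2l.
by rewrite expnS mulnC divnMA addnn -muln2 leq_trunc_div.
Qed.

(* For the odd part of [n`!], the step 4 is invertible, which turns the product
   into one of consecutive integers. *)
Lemma fact_dvd_rise4 c n : odd c -> n`! %| 2 ^ n * rise4 c n.
Proof.
move=> oc; rewrite -(@partnC 2 n`!) ?fact_gt0 // Gauss_dvd ?coprime_partC //.
apply/andP; split; first by rewrite p_part dvdn_mulr // dvdn_exp2l ?logn2_fact_le.
apply: dvdn_mull; set m := (n`!)`_(2^'); have co : coprime 4 m.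
  by apply: (@coprimeXl 2 2); rewrite coprime2n odd_2'nat part_pnat.
have m0 : 0 < m by apply: part_gt0.
(* Modulo [m], [y / 4] plays the role of [c / 4]. Adding [m] keeps the predecessor in [x] from being
   truncated at 0. *)
pose y := chinese 4 m 0 c; have y4 : 4 %| y by rewrite /dvdn (chinese_modl co) mod0n.
have ym : y = c %[mod m] by exact: chinese_modr.
have n0 := @leq_addl (y %/ 4) m; pose x := (y %/ 4 + m).-1.
suff E k : rise4 c k = 4 ^ k * \prod_(j < k) (x + j.+1) %[mod m].
  rewrite /dvdn E -/(dvdn _ _) dvdn_mull // prod_addn_bin dvdn_mull //.
  exact: dvdn_part.
have step j : 4 * j + c = 4 * (x + j.+1) %[mod m].
  have -> : 4 * (x + j.+1) = 4 * m + (4 * j + y).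
    by rewrite /x -{2}(divnK y4); move: m0 n0; clear; lia.
  by rewrite modnMDl -modnDmr -ym modnDmr.
elim: k => [|k IHk]; first by rewrite /rise4 !big_ord0.
rewrite rise4S big_ord_recr /= expnS -modnMm IHk (step k) modnMm.
by rewrite [4 * 4 ^ k]mulnC mulnACA.
Qed.

(* Up to sign, [padeV k * padeU (r - k)] is the product of the differences between the node
   [4 * k + 1] and the other nodes [4 * j] and [4 * j + 1], [j <= r]; for the node [4 * k]
   it is [padeU k * padeV (r - k)].  The factor [padeN r] clears these denominators. *)
Definition padeU n := 4 ^ n * n`! * rise4 3 n.
Definition padeV n := 4 ^ n * n`! * rise4 5 n.
Definition padeN r := 8 ^ r * rise4 3 r * rise4 5 r.
Definition pade_coef r k := padeN r %/ (padeV k * padeU (r - k)).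

Lemma padeU_gt0 n : 0 < padeU n.
Proof. by rewrite /padeU !muln_gt0 expn_gt0 fact_gt0 rise4_gt0. Qed.

Lemma padeV_gt0 n : 0 < padeV n.
Proof. by rewrite /padeV !muln_gt0 expn_gt0 fact_gt0 rise4_gt0. Qed.

Lemma padeN_gt0 n : 0 < padeN n.
Proof. by rewrite /padeN !muln_gt0 expn_gt0 !rise4_gt0. Qed.

(** For [r = k + l], the products in [padeN r] split off those of [padeV k] and [padeU l]. The two
    that remain, with [2 ^ r] taken from [8 ^ r], are a multiple of [k! * l!]. *)
Lemma pade_coefE r k : k <= r -> pade_coef r k * (padeV k * padeU (r - k)) = padeN r.
Proof.
move=> kr; apply: divnK; rewrite /padeN /padeU /padeV.
have rE : r = k + (r - k) by rewrite subnKC.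
move: (r - k) rE => l ->.
have o3 : odd (4 * l + 3) by lia.
have o5 : odd (4 * k + 5) by lia.
have d := dvdn_mul (fact_dvd_rise4 k o3) (fact_dvd_rise4 l o5).
rewrite [rise4 5 (k + l)]rise4D [k + l]addnC [rise4 3 (l + k)]rise4D -[8]/(2 * 4) expnMn !expnD.
have := dvdn_mul (dvdnn (4 ^ k * 4 ^ l * rise4 5 k * rise4 3 l)) d.
by congr (_ %| _); ring.
Qed.

Lemma rise4_le c x n : c <= 4 * x.+1 -> rise4 c n <= 4 ^ n * ('C(x + n, n) * n`!).
Proof.
move=> cx; rewrite -prod_addn_bin; elim: n => [|n IHn]; first by rewrite /rise4 !big_ord0.
have h : 4 * n + c <= 4 * (x + n.+1) by lia.
rewrite rise4S expnS big_ord_recr /=; apply: leq_trans (leq_mul IHn h) _.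
by apply: eq_leq; ring.
Qed.

Lemma bin_le_exp2 n k : 'C(n, k) <= 2 ^ n.
Proof.
case: (leqP k n) => [kn|/bin_small-> //]; rewrite -[2]/(1 + 1) expnDn.
rewrite (bigD1 (Ordinal (kn : k < n.+1))) //= !exp1n !muln1; exact: leq_addr.
Qed.

(** With [l = r - k], what is left after cancellation is [2 ^ r] times two rising products over [k!]
    and [l!]. These are at most [4 ^ k * 'C(r, k)] and [4 ^ l * 'C(r.+1, l)]. Only the second
    binomial is estimated by a power of 2. *)
Lemma pade_coef_le r k : k <= r -> pade_coef r k <= 2 * 16 ^ r * 'C(r, k).
Proof.
move=> kr; have g0 : 0 < padeV k * padeU (r - k) by rewrite muln_gt0 padeV_gt0 padeU_gt0.
rewrite -(leq_pmul2r g0) pade_coefE // /padeN /padeU /padeV.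
have rE : r = r - k + k by rewrite subnK.
move: (r - k) rE => l ->; rewrite [rise4 3 _]rise4D [l + k]addnC [rise4 5 _]rise4D.
have h3 := @rise4_le (4 * l + 3) l k ltac:(lia).
have h5 := @rise4_le (4 * k + 5) k.+1 l ltac:(lia).
have {}h5 := leq_trans h5 (leq_mul (leqnn _) (leq_mul (bin_le_exp2 _ _) (leqnn _))).
have h := leq_mul (leqnn (8 ^ (k + l) * rise4 3 l * rise4 5 k)) (leq_mul h3 h5).
apply: (leq_trans (leq_trans (eq_leq _) h)); first by ring.
rewrite [l + k]addnC addSn expnS !expnD -[16]/(8 * 2) !expnMn.
by apply: eq_leq; ring.
Qed.

Lemma sum_pade_coef_le r : \sum_(k < r.+1) pade_coef r k <= 2 * 32 ^ r.
Proof.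
apply: (@leq_trans (\sum_(k < r.+1) 2 * 16 ^ r * 'C(r, k))).
  by apply: leq_sum => k _; apply: pade_coef_le; rewrite -ltnS.
rewrite -big_distrr /= -[32]/(16 * 2) expnMn mulnA leq_mul2l; apply/orP; right.
by rewrite -[2]/(1 + 1) expnDn; apply: leq_sum => i _; rewrite !exp1n !muln1.
Qed.

Lemma padeN_le r : padeN r <= 32 ^ r * (2 * r).+1`!.
Proof.
rewrite /padeN; elim: r => [|r IHr]; first by rewrite /rise4 !big_ord0.
rewrite !rise4S mulnS !addSn add0n 2!factS !expnS.
have h : (4 * r + 3) * (4 * r + 5) <= 4 * ((2 * r).+3 * (2 * r).+2) by nia.
have := leq_mul (leqnn 8) (leq_mul IHr h).
by congr (_ <= _); ring.
Qed.

Local Open Scope ring_scope.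

Lemma padeUS n : padeU n.+1 = (padeU n * (4 * n.+1 * (4 * n + 3)))%N.
Proof. by rewrite /padeU rise4S factS expnS; ring. Qed.

Lemma padeVS n : padeV n.+1 = (padeV n * (4 * n.+1 * (4 * n + 5)))%N.
Proof. by rewrite /padeV rise4S factS expnS; ring. Qed.

Lemma padeU_prod (F : pzSemiRingType) n :
  (padeU n)%:R = \prod_(i < n) (4 * i.+1 * (4 * i + 3))%:R :> F.
Proof.
elim: n => [|n IHn]; first by rewrite big_ord0 /padeU /rise4 big_ord0.
by rewrite big_ord_recr /= -IHn padeUS -natrM.
Qed.

Lemma padeV_prod (F : pzSemiRingType) n :
  (padeV n)%:R = \prod_(i < n) (4 * i.+1 * (4 * i + 5))%:R :> F.
Proof.
elim: n => [|n IHn]; first by rewrite big_ord0 /padeV /rise4 big_ord0.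
by rewrite big_ord_recr /= -IHn padeVS -natrM.
Qed.

(** * The approximant as a divided difference *)

Definition pade_nodes (r : nat) : seq nat :=
  [seq (4 * k)%N | k <- index_iota 0 r.+1] ++ [seq (4 * k).+1 | k <- index_iota 0 r.+1].

(** The factors on either side of [k] are indexed by their distance from [k] minus one, hence the
    reversal of the lower range. *)
Lemma prod_around (F : comPzRingType) (r k : nat) (G f g : nat -> F) : (k <= r)%N ->
  (forall i, (i < k)%N -> G i = f (k - i.+1)%N) ->
  (forall i, G (k + i.+1)%N = g i) ->
  \prod_(i < r.+1) G i = (\prod_(i < k) f i) * G k * \prod_(i < r - k) g i.
Proof.
move=> kr Gf Gg; have rE : r.+1 = (k + (r - k).+1)%N by lia.
rewrite -(big_mkord xpredT G) {1}rE big_mkord big_split_ord big_ord_recl /= addn0 mulrA.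
congr (_ * _ * _); last by apply: eq_bigr => i _; exact: Gg.
rewrite (reindex_inj rev_ord_inj) /=; apply: eq_bigr => i _.
by rewrite Gf ?ltn_subrL //; [congr f; case: i => /= *; lia | case: i => /= *; lia].
Qed.

Definition node_pair (F : numFieldType) (e i : nat) : F :=
  (if e == (4 * i)%N then 1 else e%:R - (4 * i)%:R) *
  (if e == (4 * i).+1 then 1 else e%:R - (4 * i).+1%:R).

Lemma node_prod_nodesE (F : numFieldType) r e :
  node_prod F (pade_nodes r) e = \prod_(i < r.+1) node_pair F e i.
Proof.
rewrite /node_prod /pade_nodes big_cat !big_map !big_mkord !(big_mkcond (fun i => _ != e)) /=.
by rewrite -big_split; apply: eq_bigr => i _ /=; rewrite ![_ == e]eq_sym !if_neg.
Qed.

(** The nodes [4 * i] and [4 * i + 1] with [i != k] lie on the same side of [4 * k], so their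
    factors have a positive product. The sign comes from the partner [4 * k + 1] alone. *)
Lemma node_prod_even (F : numFieldType) r k : (k <= r)%N ->
  node_prod F (pade_nodes r) (4 * k) = - (padeU k * padeV (r - k))%:R.
Proof.
move=> kr; rewrite node_prod_nodesE.
rewrite (@prod_around F r k (node_pair F (4 * k)) (fun j => (4 * j.+1 * (4 * j + 3))%:R)
   (fun j => (4 * j.+1 * (4 * j + 5))%:R) kr) /node_pair => [|i ik|i].
- rewrite -padeU_prod -padeV_prod eqxx ifF; last by apply/eqP; lia.
  by rewrite natrM -natr1; ring.
- rewrite !ifF; try by apply/eqP; lia.
  have -> : k = (i + (k - i.+1).+1)%N by lia.
  by move: (k - i.+1)%N => j; rewrite -!natrB; try lia; rewrite -natrM; congr (_%:R); lia.
- rewrite !ifF; try by apply/eqP; lia.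
  rewrite -[LHS]mulrNN !opprB -!natrB; try lia.
  by rewrite -natrM; congr (_%:R); lia.
Qed.

Lemma node_prod_odd (F : numFieldType) r k : (k <= r)%N ->
  node_prod F (pade_nodes r) (4 * k).+1 = (padeV k * padeU (r - k))%:R.
Proof.
move=> kr; rewrite node_prod_nodesE.
rewrite (@prod_around F r k (node_pair F (4 * k).+1) (fun j => (4 * j.+1 * (4 * j + 5))%:R)
   (fun j => (4 * j.+1 * (4 * j + 3))%:R) kr) /node_pair => [|i ik|i].
- rewrite -padeU_prod -padeV_prod eqxx ifF; last by apply/eqP; lia.
  by rewrite natrM -natr1; ring.
- rewrite !ifF; try by apply/eqP; lia.
  have -> : k = (i + (k - i.+1).+1)%N by lia.
  by move: (k - i.+1)%N => j; rewrite -!natrB; try lia; rewrite -natrM; congr (_%:R); lia.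
- rewrite !ifF; try by apply/eqP; lia.
  rewrite -[LHS]mulrNN !opprB -!natrB; try lia.
  by rewrite -natrM; congr (_%:R); lia.
Qed.

(** The polynomial [B] of the approximant [t B(t^4) - A(t^4)]; [pade_num] is [A], with the same
    coefficients in reverse order. *)
Definition pade_den (F : numFieldType) (r : nat) : {poly F} :=
  \poly_(k < r.+1) (pade_coef r k)%:R.
Definition pade_num (F : numFieldType) (r : nat) : {poly F} :=
  \poly_(k < r.+1) (pade_coef r (r - k))%:R.

Lemma comp_poly_Xn (F : numFieldType) n m (E : nat -> F) :
  (\poly_(i < n) E i) \Po 'X^m = \sum_(i < n) E i *: 'X^(m * i).
Proof.
rewrite poly_def raddf_sum; apply: eq_bigr => i _ /=.
by rewrite comp_polyZ comp_Xn_poly exprM.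
Qed.

Lemma pade_divdiffX (F : numFieldType) r :
  (padeN r)%:R *: divdiffX F (pade_nodes r) =
  'X * (pade_den F r \Po 'X^4) - (pade_num F r \Po 'X^4).
Proof.
rewrite /pade_den /pade_num !comp_poly_Xn /divdiffX {1}/pade_nodes big_cat !big_map !big_mkord /=.
rewrite [X in _ *: X]addrC scalerDr; congr (_ + _).
  rewrite mulr_sumr scaler_sumr; apply: eq_bigr => i _ /=.
  have ir : (i <= r)%N by rewrite -ltnS.
  rewrite scalerA node_prod_odd // -(pade_coefE ir) natrM mulfK.
    by rewrite exprS scalerAr.
  by rewrite pnatr_eq0 -lt0n muln_gt0 padeV_gt0 padeU_gt0.
rewrite -sumrN scaler_sumr; apply: eq_bigr => i _ /=.
have ir : (i <= r)%N by rewrite -ltnS.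
rewrite scalerA node_prod_even // -(pade_coefE (leq_subr i r)) natrM subKn // mulnC.
rewrite invrN mulrN mulfK ?scaleNr //.
by rewrite pnatr_eq0 -lt0n muln_gt0 padeV_gt0 padeU_gt0.
Qed.

(** There are [2 * r + 2] nodes, hence the exponent. The value of [q] at 1 is
    [padeN r / (2 * r + 1)!]. *)
Lemma pade_remainder (F : numFieldType) r :
  exists q : {poly F}, [/\ 'X * (pade_den F r \Po 'X^4) - (pade_num F r \Po 'X^4) =
    ('X - 1) ^+ (2 * r).+1 * q, forall i, 0 <= q`_i & q.[1] <= (32 ^ r)%:R].
Proof.
have [||x|q [qE q0 q1]] := @divdiffX_nneg_quotient F (4 * r).+2 0 (2 * r).+1 (pade_nodes r).
- rewrite cat_uniq !map_inj_uniq ?iota_uniq ?andbT; try by move=> x y; lia.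
  by apply/hasPn => _ /mapP[x _ ->]; apply/mapP => -[y _]; lia.
- rewrite size_cat !size_map !size_iota; lia.
- rewrite mem_cat mem_iota => /orP[] /mapP[k]; rewrite mem_index_iota => h ->; lia.
exists ((padeN r)%:R *: q); rewrite -pade_divdiffX qE scalerAr; split=> // [i|].
  by rewrite coefZ mulr_ge0 ?ler0n.
rewrite hornerZ q1 ler_pdivrMr ?ltr0n ?fact_gt0 // -natrM ler_nat.
exact: padeN_le.
Qed.

(** These are the constant coefficients of the two products in the determinant of consecutive
    approximants. Both are [padeN r * padeN r.+1] over denominators which differ only in the factors
    [4 * r + 3] and [4 * r + 5]. *)
Lemma pade_coef_det r :
  pade_coef r r * pade_coef r.+1 0 <> pade_coef r.+1 r.+1 * pade_coef r 0.
Proof.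
have e0 : padeU 0 = 1%N /\ padeV 0 = 1%N by rewrite /padeU /padeV /rise4 !big_ord0.
have := pade_coefE (leqnn r); have := pade_coefE (leqnn r.+1).
have := pade_coefE (leq0n r); have := pade_coefE (leq0n r.+1).
rewrite !subnn !subn0 !e0.1 !e0.2 !mul1n !muln1 padeUS padeVS.
have := padeU_gt0 r; have := padeV_gt0 r; have := padeN_gt0 r; have := padeN_gt0 r.+1.
move: (pade_coef _ _) (pade_coef _ _) (pade_coef _ _) (pade_coef _ _).
move: (padeU r) (padeV r) (padeN r) (padeN r.+1) => u v n n' a b c d n0 n0' v0 u0.
move=> dE cE bE aE ad.
have : n * n' * (4 * r + 5) = n * n' * (4 * r + 3).
  rewrite -{1}aE -{1}dE -{1}cE -{1}bE.
  transitivity (a * d * (v * u * (4 * r.+1 * (4 * r + 3)) * (4 * r + 5))); first by ring.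
  by rewrite ad; ring.
by move/eqP; rewrite eqn_pmul2l ?muln_gt0 ?n0 ?n0' // eqn_add2l.
Qed.

(* The determinant is divisible by [('X - 1) ^+ (2 * r + 1)] after substituting
   ['X^4], hence before, and has degree at most [2 * r + 1]. *)
Lemma pade_det_neq0 (F : numFieldType) r (z : F) : z != 1 ->
  (pade_num F r).[z] * (pade_den F r.+1).[z] != (pade_num F r.+1).[z] * (pade_den F r).[z].
Proof.
move=> z1; set A := pade_num F; set B := pade_den F.
rewrite -subr_eq0 -!hornerM -hornerN -hornerD; set D := A r * B r.+1 - A r.+1 * B r.
have D0 : D != 0.
  apply: contra_notN (@pade_coef_det r) => /eqP/(congr1 (horner^~ 0)).
  rewrite !hornerE !horner_coef0 !coef_poly !ltn0Sn !subn0 => /eqP.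
  by rewrite subr_eq0 -!natrM eqr_nat => /eqP.
have sD : (size D <= (2 * r).+2)%N.
  have sA k : (size (A k) <= k.+1)%N by exact: size_poly.
  have sB k : (size (B k) <= k.+1)%N by exact: size_poly.
  apply: leq_trans (size_polyD _ _) _; rewrite size_polyN geq_max; apply/andP; split.
    apply: leq_trans (size_polyMleq _ _) _; have := sA r; have := sB r.+1.
    by move: (size _) (size _) => x y; lia.
  apply: leq_trans (size_polyMleq _ _) _; have := sA r.+1; have := sB r.
  by move: (size _) (size _) => x y; lia.
have [q0 [Q0 _ _]] := pade_remainder F r; have [q1 [Q1 _ _]] := pade_remainder F r.+1.
have DX : 'X * (D \Po 'X^4) = ('X - 1) ^+ (2 * r).+1 *
   ((A r \Po 'X^4) * ('X - 1) ^+ 2 * q1 - (A r.+1 \Po 'X^4) * q0).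
  have e : (2 * r.+1).+1 = ((2 * r).+1 + 2)%N by lia.
  transitivity ((A r \Po 'X^4) * (('X - 1) ^+ ((2 * r).+1 + 2) * q1)
      - (A r.+1 \Po 'X^4) * (('X - 1) ^+ (2 * r).+1 * q0)); last by rewrite exprD; ring.
  by rewrite -e -Q0 -Q1 /D rmorphB !rmorphM /= -/A -/B; ring.
move: DX; set H := (_ - _ * q0) => DX.
have [j [E ED DE]] := multiplicity_XsubC D 1; rewrite D0 /= in ED.
have mj : ((2 * r).+1 <= j)%N.
  rewrite leqNgt; apply/negP => jm.
  (* The second factor is 4 at 1, so the substitution preserves the multiplicity [j] of the root
     1. *)
  have X41 : 'X^4 - 1 = ('X - 1) * ('X^3 + 'X^2 + 'X + 1) :> {poly F} by ring.
  move: DX; rewrite DE rmorphM rmorphXn rmorphB /= comp_polyX comp_polyC polyC1.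
  rewrite X41 exprMn_comm; last exact: mulrC.
  have -> : (2 * r).+1 = (j + ((2 * r).+1 - j).-1.+1)%N by lia.
  rewrite exprD -mulrA mulrCA mulrC => DX.
  have X1j : ('X - 1 : {poly F}) ^+ j != 0 by rewrite expf_neq0 // -polyC1 polyXsubC_eq0.
  move: DX; rewrite mulrCA -mulrA => /(mulfI X1j) /(congr1 (horner^~ 1)).
  rewrite !(hornerE, horner_exp, horner_comp, hornerXn, expr1n) subrr exprS !mul0r => /eqP.
  rewrite mulf_eq0 -[E.[1] == 0]/(root E 1) (negPf ED) orbF expf_eq0 => /andP[_].
  by rewrite -[1]/(1%:R) -!natrD pnatr_eq0.
have E0 : E != 0 by apply: contraNneq D0 => E0; rewrite DE E0 mul0r.
move: sD; rewrite DE size_Mmonic ?monic_exp ?monicXsubC // size_exp_XsubC addnS /= => sE.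
have /size_poly1P[c c0 ->] : size E == 1 by move: sE mj E0; rewrite -size_poly_gt0; move: (size _) => x; lia.
rewrite hornerM hornerC horner_exp hornerXsubC mulf_neq0 // expf_neq0 //.
by rewrite subr_eq0.
Qed.

(** * Approximation by Gaussian integers *)

Definition is_gauss (C : numClosedFieldType) (x : C) : Prop :=
  exists a b : int, x = a%:~R + b%:~R * 'i.

Lemma gauss_nat (C : numClosedFieldType) n : is_gauss (n%:R : C).
Proof. by exists n%:Z, 0; rewrite mul0r addr0. Qed.

Lemma gauss_i (C : numClosedFieldType) : is_gauss ('i : C).
Proof. by exists 0, 1; rewrite mul1r add0r. Qed.

Lemma gaussD (C : numClosedFieldType) (x y : C) :
  is_gauss x -> is_gauss y -> is_gauss (x + y).
Proof.
by move=> [a [b ->]] [c [d ->]]; exists (a + c), (b + d); rewrite !intrD; ring.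
Qed.

Lemma gaussM (C : numClosedFieldType) (x y : C) :
  is_gauss x -> is_gauss y -> is_gauss (x * y).
Proof.
move=> [a [b ->]] [c [d ->]]; exists (a * c - b * d), (a * d + b * c).
rewrite !(intrD, rmorphN, intrM) /=; have := sqrCi C; move: 'i => i i2.
transitivity (a%:~R * c%:~R + b%:~R * d%:~R * i ^+ 2 + (a%:~R * d%:~R + b%:~R * c%:~R) * i).
  by ring.
by rewrite i2; ring.
Qed.

Lemma gaussN (C : numClosedFieldType) (x : C) : is_gauss x -> is_gauss (- x).
Proof. by move=> [a [b ->]]; exists (- a), (- b); rewrite opprD !rmorphN mulNr. Qed.

Lemma gaussX (C : numClosedFieldType) (x : C) n : is_gauss x -> is_gauss (x ^+ n).
Proof.
move=> gx; elim: n => [|n IHn]; first exact: (gauss_nat C 1).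
by rewrite exprS; apply: gaussM.
Qed.

Lemma conj_gauss (C : numClosedFieldType) (a b : int) :
  (a%:~R + b%:~R * 'i : C)^* = a%:~R - b%:~R * 'i.
Proof. by rewrite rmorphD rmorphM /= conjCi !rmorph_int mulrN. Qed.

Lemma gauss_conj (C : numClosedFieldType) (x : C) : is_gauss x -> is_gauss x^*.
Proof. by move=> [a [b ->]]; exists a, (- b); rewrite conj_gauss rmorphN mulNr. Qed.

Lemma sqr_norm_gauss (C : numClosedFieldType) (a b : int) :
  `|a%:~R + b%:~R * 'i : C| ^+ 2 = (a ^+ 2 + b ^+ 2)%:~R.
Proof.
rewrite normCK conj_gauss intrD !rmorphXn /=; have := sqrCi C; move: 'i => i i2.
by rewrite mulrC -subr_sqr exprMn i2 mulrN1 opprK.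
Qed.

Lemma gauss_norm_ge1 (C : numClosedFieldType) (x : C) :
  is_gauss x -> x != 0 -> 1 <= `|x|.
Proof.
move=> [a [b xE]] x0; rewrite -(@ler_pXn2r _ 2) ?nnegrE ?ler01 ?normr_ge0 // expr1n.
have : 0 < `|x| ^+ 2 by rewrite exprn_gt0 // normr_gt0.
by rewrite {1 2}xE sqr_norm_gauss ltr0z -[1]/(1%:~R) ler_int; lia.
Qed.

Lemma norm_sub1_le_pow4 (C : numClosedFieldType) (t : C) :
  0 <= 'Re t -> 0 <= 'Re (t ^+ 2) -> `|t - 1| <= `|t ^+ 4 - 1|.
Proof.
move=> t1 t2; have -> : t ^+ 4 - 1 = (t - 1) * ((t + 1) * (t ^+ 2 + 1)) by ring.
have Re1 (x : C) : 0 <= 'Re x -> 1 <= `|x + 1|.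
  move=> x0; apply: le_trans (leif_Re_Creal _); rewrite raddfD /= (Creal_ReP 1 _) ?lerDr //.
rewrite normrM ler_peMr // normrM mulr_ege1 ?Re1 //.
Qed.

(** Multiplying [t] by ['i] changes the sign of ['Re (t ^+ 2)], and multiplying it by -1 changes the
    sign of ['Re t] only, so both can be made nonnegative. *)
Lemma quarter_turn (C : numClosedFieldType) (t : C) :
  exists k : nat, `|'i ^+ k * t - 1| <= `|t ^+ 4 - 1|.
Proof.
suff [k [h1 h2]] : exists k : nat, 0 <= 'Re ('i ^+ k * t) /\ 0 <= 'Re (('i ^+ k * t) ^+ 2).
  exists k; apply: le_trans (norm_sub1_le_pow4 h1 h2) _.
  by rewrite exprMn exprAC [_ ^+ 4](exprM _ 2 2) sqrCi sqrrN !expr1n mul1r.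
have choose_sign (s : C) : 0 <= 'Re (s ^+ 2) -> exists k : nat, 0 <= 'Re ('i ^+ k * s) /\
    0 <= 'Re (('i ^+ k * s) ^+ 2).
  move=> s2; have [s0|s0] := real_ge0P (Creal_Re s).
    by exists 0%N; rewrite expr0 mul1r.
  by exists 2%N; rewrite sqrCi mulN1r sqrrN raddfN oppr_ge0 ltW.
have [t0|t0] := real_ge0P (Creal_Re (t ^+ 2)); first exact: choose_sign.
have [|k] := choose_sign ('i * t).
  by rewrite exprMn sqrCi mulN1r raddfN oppr_ge0 ltW.
by rewrite mulrA -exprSr; exists k.+1.
Qed.

(* The number close to 1 has for fourth power the quotient of
   [(1 + 'i) * b0 ^+ 4 = - 239 + 'i] by its conjugate. *)
Lemma root_near_base (C : numClosedFieldType) (b0 : C) : b0 = 3 + 2 * 'i ->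
  exists zeta : C, zeta ^+ 4 = 'i /\ `|zeta * (b0 / b0^*) - 1| <= 416^-1.
Proof.
move=> b0E; pose z0 : C := 4.-root 'i; have z04 : z0 ^+ 4 = 'i by exact: rootCK.
have b0c : b0^* = 3 - 2 * 'i.
  by have := conj_gauss C 3 2; rewrite -b0E.
have nb0 : `|b0| ^+ 2 = 13.
  by have := sqr_norm_gauss C 3 2; rewrite -b0E.
have nb04 : `|b0| ^+ 4 = 169 by rewrite (exprM _ 2 2) nb0 -natrX.
have b00 : b0 != 0.
  apply/eqP => h; move: nb0; rewrite h normr0 expr0n /= => /eqP.
  by rewrite eq_sym pnatr_eq0.
have bc0 : b0^* != 0 by rewrite conjC_eq0.
have [k hk] := quarter_turn (z0 * (b0 / b0^*)).
exists ('i ^+ k * z0).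
have ik : ('i ^+ k) ^+ 4 = 1 :> C by rewrite exprAC (exprM _ 2 2) sqrCi sqrrN !expr1n.
split; first by rewrite exprMn ik mul1r.
move: hk; rewrite mulrA; set t := _ * (b0 / _); set x := `|t - 1| => hk.
have b04 : b0 ^+ 4 = - 119 + 120 * 'i.
  rewrite b0E; have := sqrCi C; move: 'i => i i2.
  transitivity (81 + 216 * i + 216 * i ^+ 2 + 96 * (i ^+ 2 * i) + 16 * (i ^+ 2) ^+ 2); first by ring.
  by rewrite i2; ring.
have b0c4 : b0^* ^+ 4 = - 119 - 120 * 'i.
  rewrite b0c; have := sqrCi C; move: 'i => i i2.
  transitivity (81 - 216 * i + 216 * i ^+ 2 - 96 * (i ^+ 2 * i) + 16 * (i ^+ 2) ^+ 2); first by ring.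
  by rewrite i2; ring.
(* The exact value is [sqrt 2 / 169], and [169 / 119] exceeds [sqrt 2]. *)
have t4 : `|(z0 * (b0 / b0^*)) ^+ 4 - 1| <= 119^-1.
  rewrite exprMn z04 expr_div_n mulrA.
  have -> : 'i * b0 ^+ 4 / b0^* ^+ 4 - 1 = ('i * b0 ^+ 4 - b0^* ^+ 4) / b0^* ^+ 4.
    by rewrite mulrBl divff // expf_neq0.
  have -> : 'i * b0 ^+ 4 - b0^* ^+ 4 = (-1)%:~R + 1%:~R * 'i.
    rewrite b04 b0c4; have := sqrCi C; move: 'i => i i2.
    transitivity (119 + i + 120 * i ^+ 2); first by ring.
    by rewrite i2; ring.
  rewrite normf_div normrX norm_conjC nb04 ler_pdivrMr ?ltr0n //.
  rewrite -(@ler_pXn2r _ 2) ?nnegrE ?mulr_ge0 ?invr_ge0 ?ler0n ?normr_ge0 //.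
  have -> : (119^-1 * 169) ^+ 2 = 169 ^+ 2 / 119 ^+ 2 :> C by rewrite exprMn exprVn mulrC.
  rewrite sqr_norm_gauss ler_pdivlMr ?exprn_gt0 ?ltr0n // -[_%:~R]/(2%:R : C).
  by rewrite -!natrX -natrM ler_nat.
have x0 : 0 <= x by exact: normr_ge0.
have x1 : x <= 119^-1 by apply: le_trans t4.
(* The crude bound [x <= 1 / 119] makes both [t + 1] and [t ^+ 2 + 1] at least [15 / 8] in absolute
   value, which improves it to [64 / (119 * 225)], less than [1 / 416]. *)
have near (s : C) : `|s - 1| <= 8^-1 -> 15 / 8 <= `|s + 1|.
  move=> s1; have : 2 <= `|s + 1| + `|s - 1|.
    apply: le_trans (ler_normB _ _); rewrite le_eqVlt; apply/orP; left.
    by rewrite -[2]/(2%:R) -normr_nat; apply/eqP; congr (`|_|); ring.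
  rewrite -lerBlDr; apply: le_trans; rewrite lerBrDr -lerBrDl; apply: le_trans s1 _.
  by have -> : 2 - 15 / 8 = 8^-1 :> C by field.
have tp1 : 15 / 8 <= `|t + 1|.
  by apply/near/(le_trans x1); rewrite lef_pV2 ?posrE ?ltr0n // ler_nat.
have tp2 : 15 / 8 <= `|t ^+ 2 + 1|.
  apply: near; have -> : t ^+ 2 - 1 = (t - 1) * (t + 1) by ring.
  have t3 : `|t + 1| <= 3.
    have -> : t + 1 = (t - 1) + 2 by ring.
    apply: le_trans (ler_normD _ _) _; rewrite normr_nat -[3]/(1 + 2 : C) lerD2r.
    by apply: le_trans x1 _; rewrite invf_le1 ?ltr0n // ler1n.
  rewrite normrM; apply: le_trans (ler_pM x0 (normr_ge0 _) x1 t3) _.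
  by rewrite mulrC ler_pdivrMr ?ltr0n // mulrC ler_pdivlMr ?ltr0n // -natrM ler_nat.
have t41 : x * (`|t + 1| * `|t ^+ 2 + 1|) <= 119^-1.
  apply: le_trans t4; rewrite le_eqVlt; apply/orP; left; apply/eqP.
  rewrite /x -!normrM; congr (`|_|).
  have -> : (z0 * (b0 / b0^*)) ^+ 4 = t ^+ 4 by rewrite /t [in RHS]exprMn [in RHS]exprMn ik mul1r -exprMn.
  by ring.
have : x * (15 / 8 * (15 / 8)) <= 119^-1.
  by apply: le_trans t41; apply: ler_wpM2l => //; apply: ler_pM => //; rewrite mulr_ge0 ?invr_ge0 ?ler0n.
rewrite -ler_pdivlMr ?mulr_gt0 ?invr_gt0 ?ltr0n // => h; apply: le_trans h _.
have -> : 119^-1 / (15 / 8 * (15 / 8)) = 64 / (119 * 225) :> C by field.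
rewrite ler_pdivrMr ?mulr_gt0 ?ltr0n // mulrC -ler_pdivrMr ?invr_gt0 ?ltr0n // invrK.
by rewrite -!natrM ler_nat.
Qed.

Lemma gauss_sum (C : numClosedFieldType) n (f : 'I_n -> C) :
  (forall i, is_gauss (f i)) -> is_gauss (\sum_(i < n) f i).
Proof.
move=> gf; apply: big_ind => [|x y|i _]; [exact: (gauss_nat C 0) | exact: gaussD | exact: gf].
Qed.

Lemma norm_horner_nneg (C : numClosedFieldType) (q : {poly C}) (t : C) :
  (forall i, 0 <= q`_i) -> `|t| = 1 -> `|q.[t]| <= q.[1].
Proof.
move=> q0 t1; rewrite !horner_coef; apply: le_trans (ler_norm_sum _ _ _) _.
apply: ler_sum => i _; rewrite normrM normrX t1 !expr1n !mulr1 ger0_norm //.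
Qed.

(** The root [zeta] cancels in [t0 / t1], so [(t0 / t1) * B(z) - A(z)] with [z = t0 ^+ 4], cleared
    of denominators, is a Gaussian integer [L n]. Its size is controlled by the distance of [t1]
    from 1 and the remainder of the approximant at [t0]. *)
Lemma pade_linear_form (C : numClosedFieldType) (b0 b zeta : C) (k r : nat) :
  is_gauss b0 -> is_gauss b -> b0 != 0 -> b != 0 -> zeta ^+ 4 = 'i ->
  'i * (b0 / b0^*) ^+ 4 != 1 ->
  exists2 p : nat, p = r \/ p = r.+1 &
    1 <= `|b| * `|b0| * (32 * `|b0| ^+ 4) ^+ p *
      (2 * `|'i ^+ k * zeta * (b / b^*) - 1| + `|zeta * (b0 / b0^*) - 1| ^+ (2 * p).+1).
Proof.
move=> gb0 gb b00 b_0 z4 z1.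
have ni : `|'i : C| = 1 by exact: normCi.
have nz : `|zeta| = 1.
  by apply/eqP; rewrite -(@pexpr_eq1 _ _ 4) ?normr_ge0 // -normrX z4 ni.
have nc (x : C) : x != 0 -> `|x / x^*| = 1.
  by move=> x0; rewrite normf_div norm_conjC divff // normr_eq0.
set z := 'i * _ in z1; pose xi : C := 'i * b0 ^+ 4; pose eta : C := b0^* ^+ 4.
have c0 : b0^* != 0 by rewrite conjC_eq0.
have c_0 : b^* != 0 by rewrite conjC_eq0.
have eta0 : eta != 0 by rewrite expf_neq0.
have zE : z = xi / eta by rewrite /z /xi /eta expr_div_n mulrA.
have zn : `|z| = 1 by rewrite normrM normrX ni mul1r nc // expr1n.
set t0 := zeta * (b0 / b0^*); set t1 := _ * (b / b^*).
have t04 : t0 ^+ 4 = z by rewrite exprMn z4.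
have nt1 : `|t1| = 1 by rewrite normrM nc // normrM normrX ni nz expr1n !mul1r.
have gauss_eval n (E : nat -> nat) :
    is_gauss (eta ^+ n * (\poly_(i < n.+1) (E i)%:R).[z]).
  rewrite (horner_coef_wide _ (size_poly _ _)) mulr_sumr; apply: gauss_sum => i.
  rewrite coef_poly ltn_ord zE expr_div_n.
  have -> : eta ^+ n * ((E i)%:R * (xi ^+ i / eta ^+ i)) = (E i)%:R * (xi ^+ i * eta ^+ (n - i)).
    rewrite -{1}(subnK (leq_ord i)) exprD; field.
    by rewrite expf_neq0.
  apply: gaussM; first exact: gauss_nat.
  apply: gaussM; first by apply: gaussX; apply: gaussM; [exact: gauss_i | exact: gaussX].
  by do 2!apply: gaussX; exact: gauss_conj.
pose L n := b0 * b^* * (eta ^+ n * (pade_den C n).[z])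
   - 'i ^+ k * b * b0^* * (eta ^+ n * (pade_num C n).[z]).
have gL n : is_gauss (L n).
  apply: gaussD; first by apply: gaussM (gauss_eval _ _); apply: gaussM => //; exact: gauss_conj.
  apply: gaussN; apply: gaussM (gauss_eval n (fun i => pade_coef n (n - i))).
  by do 2?apply: gaussM => //; [apply: gaussX; exact: gauss_i | exact: gauss_conj].
have LE n : L n = 'i ^+ k * b * b0^* * eta ^+ n *
    ((t0 / t1) * (pade_den C n).[z] - (pade_num C n).[z]).
  have ik0 : 'i ^+ k != 0 :> C by rewrite expf_neq0 // neq0Ci.
  have zeta0 : zeta != 0 by rewrite -normr_eq0 nz oner_eq0.
  by rewrite /L /t0 /t1; field; rewrite ik0 zeta0 b_0 c0 c_0.
have LF0 n : L n = 0 -> (pade_num C n).[z] = (t0 / t1) * (pade_den C n).[z].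
  move=> /eqP; rewrite LE !mulf_eq0 !expf_eq0 (negPf (neq0Ci C)) (negPf b_0) (negPf c0).
  by rewrite !andbF /= subr_eq0 => /eqP.
(* If both vanished, [t0 / t1] would equal [A / B] in two consecutive degrees, against the
   determinant. *)
have [p pr Lp] : exists2 p : nat, p = r \/ p = r.+1 & L p != 0.
  case: (eqVneq (L r) 0) => [Lr|]; last by exists r; first by left.
  case: (eqVneq (L r.+1) 0) => [Lr1|]; last by exists r.+1; first by right.
  have /eqP[] := pade_det_neq0 r z1.
  by rewrite (LF0 _ Lr) (LF0 _ Lr1); ring.
exists p => //; apply: le_trans (gauss_norm_ge1 (gL p) Lp) _.
have Bz : `|(pade_den C p).[z]| <= 2 * 32 ^+ p.
  apply: le_trans (norm_horner_nneg _ zn) _ => [i|].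
    by rewrite coef_poly; case: ifP => _; rewrite ?ler0n.
  rewrite (horner_coef_wide _ (size_poly _ _)) -natrX -natrM.
  apply: le_trans (_ : (\sum_(i < p.+1) pade_coef p i)%:R <= _).
    rewrite natr_sum; apply: ler_sum => i _.
    by rewrite coef_poly ltn_ord expr1n mulr1.
  by rewrite ler_nat sum_pade_coef_le.
have [q [qE q0 q1]] := pade_remainder C p.
have nt0 : `|t0| = 1 by rewrite normrM nz nc // mul1r.
have Fz : `|t0 * (pade_den C p).[z] - (pade_num C p).[z]| <= 32 ^+ p * `|t0 - 1| ^+ (2 * p).+1.
  have -> : t0 * (pade_den C p).[z] - (pade_num C p).[z] = (t0 - 1) ^+ (2 * p).+1 * q.[t0].
    move/(congr1 (horner^~ t0)): qE.
    by rewrite !(hornerE, horner_exp, horner_comp, hornerXn) t04.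
  rewrite normrM normrX mulrC ler_wpM2r ?exprn_ge0 ?normr_ge0 //.
  by apply: le_trans (norm_horner_nneg q0 nt0) _; rewrite natrX in q1.
have key : `|t0 / t1 * (pade_den C p).[z] - (pade_num C p).[z]| <=
    32 ^+ p * (2 * `|t1 - 1| + `|t0 - 1| ^+ (2 * p).+1).
  have t10 : t1 != 0 by rewrite -normr_eq0 nt1 oner_eq0.
  have -> : t0 / t1 * (pade_den C p).[z] - (pade_num C p).[z] =
      t0 / t1 * (1 - t1) * (pade_den C p).[z] + (t0 * (pade_den C p).[z] - (pade_num C p).[z]).
    by field.
  apply: le_trans (ler_normD _ _) _; rewrite [leRHS]mulrDr; apply: lerD => //.
  rewrite normrM [`|t0 / t1 * _|]normrM normf_div nt0 nt1 divr1 mul1r distrC mulrC.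
  apply: le_trans (ler_wpM2r (normr_ge0 _) Bz) _.
  by rewrite mulrCA mulrA.
rewrite LE normrM.
have -> : `|'i ^+ k * b * b0^* * eta ^+ p| = `|b| * `|b0| * (`|b0| ^+ 4) ^+ p.
  by rewrite !(normrM, normrX) ni norm_conjC expr1n mul1r.
apply: le_trans (ler_wpM2l _ key) _; first by rewrite !mulr_ge0 ?exprn_ge0 ?normr_ge0.
by rewrite [in leRHS]exprMn [32 ^+ p * _ ^+ p]mulrC !mulrA.
Qed.

(** The imaginary part of [(1 + 'i) * (r + s * 'i) ^+ 4]. *)
Definition thue_form (r s : int) : int :=
  r ^+ 4 + 4 * r ^+ 3 * s - 6 * r ^+ 2 * s ^+ 2 - 4 * r * s ^+ 3 + s ^+ 4.

(** For [x = (1 + 'i) * b ^+ 4], this is [x - x^* = 2 * 'i * 'Im x] divided by [1 - 'i]. *)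
Lemma gauss_pow4_diff (C : numClosedFieldType) (r s : int) (b : C) :
  b = r%:~R + s%:~R * 'i ->
  'i * b ^+ 4 - b^* ^+ 4 = (thue_form r s)%:~R * ((-1)%:~R + 1%:~R * 'i).
Proof.
move=> ->; rewrite conj_gauss /thue_form !(intrD, intrM, rmorphN, rmorphXn) /=.
have := sqrCi C; move: 'i => i i2.
by ring: i2.
Qed.

(* Here [169 = `|3 + 2 * 'i| ^+ 4], and [416 ^ 2 = 32 * (32 * 169)] makes the second error
   term decay like [32 ^- p]. *)
Lemma pade_inequality (F : numFieldType) (M : F) (p : nat) : 0 < M -> M <= 32 ^+ p ->
  1 <= M * (4 * ((32 * 169) ^+ p * (2 * (2 / (M ^+ 2) ^+ 2) + 416^-1 ^+ (2 * p).+1))) ->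
  M ^+ 3 <= 17 * (32 * 169) ^+ p.
Proof.
move=> M0 Mp; rewrite [416^-1 ^+ _]exprSr exprM.
have -> : (416^-1 ^+ 2) ^+ p = ((32 ^+ p) ^+ 2 * 169 ^+ p)^-1 :> F.
  by rewrite exprVn exprVn [in RHS]exprAC -[in RHS]exprMn; congr (_ ^+ _)^-1; rewrite -!natrX -natrM; congr (_%:R).
rewrite exprMn; set P := 32 ^+ p in Mp *; set Q := 169 ^+ p.
have P0 : 0 < P by rewrite exprn_gt0 ?ltr0n.
have Q0 : 0 < Q by rewrite exprn_gt0 ?ltr0n.
have -> : M * (4 * (P * Q * (2 * (2 / (M ^+ 2) ^+ 2) + (P ^+ 2 * Q)^-1 * 416^-1))) =
    (1664 * (P * (P * Q)) + M ^+ 3 * M) / (104 * P * M ^+ 3).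
  by field; rewrite !lt0r_neq0.
rewrite ler_pdivlMr ?mulr_gt0 ?exprn_gt0 ?ltr0n // mul1r => h.
have M30 : 0 < M ^+ 3 by rewrite exprn_gt0.
(* One factor [M] of the last term is replaced by [P], so that the term is absorbed on the left and
   leaves 103. Then [1664 <= 17 * 103]. *)
have {}h : 104 * P * M ^+ 3 <= 1664 * (P * (P * Q)) + M ^+ 3 * P.
  by apply: le_trans h _; rewrite lerD2l ler_pM2l.
have {}h : P * (103 * M ^+ 3) <= P * (1664 * (P * Q)).
  by move: h; rewrite -lerBlDr; congr (_ <= _); ring.
move: h; rewrite ler_pM2l // => h.
have : 103 * M ^+ 3 <= 103 * (17 * (P * Q)).
  apply: le_trans h _; rewrite [leRHS]mulrA ler_pM2r ?mulr_gt0 // -natrM ler_nat //.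
by rewrite ler_pM2l ?ltr0n.
Qed.

(** Since [g] is the square of the norm of [b], the hypothesis on [g] is what [pade_inequality]
    needs with [p >= n], and its conclusion is squared, whence [289 = 17 ^ 2]. The degree [p] is [n]
    or [n.+1]. *)
Lemma thue_norm_step (r s : int) (g n : nat) : r ^+ 2 + s ^+ 2 = g%:Z ->
  thue_form r s ^+ 2 = 1 -> (g <= (32 * 32) ^ n)%N -> (g ^ 3 <= 289 * (32 * 169) ^ (2 * n.+1))%N.
Proof.
move=> gE F1 gn; pose C : numClosedFieldType := algC.
pose b : C := r%:~R + s%:~R * 'i; pose b0 : C := 3 + 2 * 'i.
have gb : is_gauss b by exists r, s.
have gb0 : is_gauss b0 by exists 3, 2.
have nb : `|b| ^+ 2 = g%:R by rewrite sqr_norm_gauss gE.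
have nb0 : `|b0| ^+ 2 = 13.
  by have := sqr_norm_gauss C 3 2; rewrite -/b0.
have nb04 : `|b0| ^+ 4 = 169 by rewrite (exprM _ 2 2) nb0 -natrX.
have nb04' : `|b0| <= 4.
  by rewrite -(@ler_pXn2r _ 2) ?nnegrE ?normr_ge0 // nb0 -natrX ler_nat.
have b00 : b0 != 0.
  apply/eqP => h; move: nb0; rewrite h normr0 expr0n /= => /eqP.
  by rewrite eq_sym pnatr_eq0.
have g0 : (0 < g)%N.
  rewrite lt0n; apply/eqP => g0; move: gE; rewrite g0 => /eqP.
  rewrite paddr_eq0 ?sqr_ge0 // !sqrf_eq0 => /andP[/eqP r0 /eqP s0].
  by move: F1; rewrite r0 s0.
have b_0 : b != 0.
  apply/eqP => h; move: nb; rewrite h normr0 expr0n /= => /eqP.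
  by rewrite eq_sym pnatr_eq0 -leqn0 leqNgt g0.
have [zeta [z4 hz]] := root_near_base (erefl b0).
(* The pair 3, 2 itself gives the Thue form the value 1, so ['i * b0 ^+ 4] differs from its
   conjugate counterpart. *)
have z1 : 'i * (b0 / b0^*) ^+ 4 != 1.
  rewrite expr_div_n mulrA; apply/eqP => h.
  have bc0 : b0^* ^+ 4 != 0 by rewrite expf_neq0 // conjC_eq0.
  have := gauss_pow4_diff (erefl (3%:~R + 2%:~R * 'i : C)).
  rewrite -[3%:~R + _]/b0 -[X in X - _](divfK bc0) h mul1r subrr => /(congr1 (fun x => `|x| ^+ 2)).
  rewrite (_ : thue_form 3 2 = 1) // mul1r sqr_norm_gauss normr0 expr0n /= => /eqP.
  by rewrite eq_sym intr_eq0.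
have [k hk] := quarter_turn (zeta * (b / b^*)).
(* The exact value is [sqrt 2 / g ^ 2]. *)
have eps : `|(zeta * (b / b^*)) ^+ 4 - 1| <= 2 / g%:R ^+ 2.
  have bc0 : b^* ^+ 4 != 0 by rewrite expf_neq0 // conjC_eq0.
  rewrite exprMn z4 expr_div_n mulrA.
  have -> : 'i * b ^+ 4 / b^* ^+ 4 - 1 = ('i * b ^+ 4 - b^* ^+ 4) / b^* ^+ 4.
    by rewrite mulrBl divff.
  rewrite (gauss_pow4_diff (erefl b)).
  rewrite normf_div normrX norm_conjC (exprM _ 2 2) nb ler_wpM2r ?invr_ge0 ?exprn_ge0 ?ler0n //.
  rewrite -(@ler_pXn2r _ 2) ?nnegrE ?normr_ge0 ?ler0n // normrM exprMn sqr_norm_gauss.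
  rewrite -normrX -rmorphXn F1 normr1 mul1r -[_%:~R]/(2%:R : C) -natrX ler_nat //.
have {eps} t1 : `|'i ^+ k * (zeta * (b / b^*)) - 1| <= 2 / g%:R ^+ 2.
  exact: le_trans hk eps.
have [p pn] := pade_linear_form k n gb0 gb b00 b_0 z4 z1.
rewrite nb04 -mulrA => lin.
have pn' : (n <= p <= n.+1)%N by case: pn => ->; rewrite ?leqnn ?leqnSn.
suff h : (g ^ 3 <= 289 * (32 * 169) ^ (2 * p))%N.
  apply: leq_trans h _; rewrite leq_mul2l leq_exp2l //; move: pn'; clear; lia.
set M := `|b| in nb lin.
have M0 : 0 < M by rewrite normr_gt0.
have Mp : M <= 32 ^+ p.
  rewrite -(@ler_pXn2r _ 2) ?nnegrE ?exprn_ge0 ?ler0n ?(ltW M0) // nb exprAC -!natrX ler_nat.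
  by apply: leq_trans gn _; rewrite leq_exp2l //; move: pn'; clear; lia.
suff h : M ^+ 3 <= 17 * (32 * 169) ^+ p.
  rewrite -(ler_nat C) !(natrX, natrM) -nb exprAC mulnC exprM -[289]/((17 ^ 2)%:R) natrX -exprMn.
  by rewrite ler_pXn2r ?nnegrE ?(mulr_ge0, exprn_ge0, ler0n, ltW M0).
have {}lin : 1 <= M * (4 * ((32 * 169) ^+ p * (2 * (2 / g%:R ^+ 2) + 416^-1 ^+ (2 * p).+1))).
  apply: le_trans lin _; rewrite -!mulrA ler_pM2l //.
  apply: ler_pM => //; rewrite ?(mulr_ge0, addr_ge0, exprn_ge0, normr_ge0, ler0n) //.
  apply: ler_wpM2l; first by rewrite exprn_ge0 ?mulr_ge0 ?ler0n.
  apply: lerD; first by rewrite ler_pM2l ?ltr0n.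
  by rewrite ler_pXn2r ?nnegrE ?invr_ge0 ?normr_ge0 ?ler0n.
by apply: pade_inequality; rewrite // nb.
Qed.

(** Applied with [c = 32] and [K = 169]. Since [K ^ 2 <= c ^ 3], the right side gains [c ^ m], at
    least [2 ^ 65] for [m >= 13], over a constant [289 * (c * K) ^ 4] below [2 ^ 61]. *)
Lemma expn_gap (c K m : nat) : (2 ^ 5 <= c)%N -> (0 < K)%N -> (K ^ 2 <= c ^ 3)%N ->
  (c * K <= 2 ^ 13)%N -> (13 <= m)%N -> (289 * (c * K) ^ (2 * m.+2) < ((c * c) ^ m) ^ 3)%N.
Proof.
move=> c5 K0 Kc cK13 m13; have m0 : (0 < m)%N by exact: leq_trans m13.
have c0 : (0 < c)%N by exact: leq_trans c5.
have h1 : (((c * K) ^ 2 * c) ^ m <= ((c * c) ^ 3) ^ m)%N.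
  by rewrite leq_exp2r // !expnMn mulnAC -expnSr leq_mul.
have h2 : ((c * K) ^ 4 <= (2 ^ 13) ^ 4)%N by rewrite leq_exp2r.
have h3 : ((c * K) ^ 4 * 289 < c ^ m)%N.
  apply: leq_ltn_trans (leq_mul h2 (isT : 289 <= 2 ^ 9)%N) _.
  apply: leq_trans (_ : (2 ^ 5) ^ m <= _)%N; last by rewrite leq_exp2r.
  rewrite -expnM -expnD -expnM ltn_exp2l //; move: m13; clear; lia.
rewrite expnAC; apply: leq_trans h1; rewrite [in leqRHS]expnMn -expnM mulnC.
have -> : (2 * m.+2 = 2 * m + 4)%N by clear; lia.
by rewrite expnD -mulnA ltn_pmul2l ?expn_gt0 ?muln_gt0 ?c0 ?K0.
Qed.

(** For the least [n] with [g <= 1024 ^ n], the lower bound [1024 ^ n.-1 < g] contradicts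
    [thue_norm_step] as soon as [n > 13], and [1024 ^ 13 = 2 ^ 130]. *)
Lemma thue_norm_le (r s : int) (g : nat) : r ^+ 2 + s ^+ 2 = g%:Z ->
  thue_form r s ^+ 2 = 1 -> (g <= 2 ^ 130)%N.
Proof.
move=> gE F1; have step := thue_norm_step gE F1.
have [n gn nmin] : exists2 n, (g <= (32 * 32) ^ n)%N & forall m, (g <= (32 * 32) ^ m)%N -> (n <= m)%N.
  have ex : exists n, (g <= (32 * 32) ^ n)%N.
    by exists g; apply: ltnW; apply: ltn_expl.
  by exists (ex_minn ex); case: ex_minnP.
case: (leqP n 13) => n13.
  apply: leq_trans gn _; rewrite -[32%N]/(2 ^ 5)%N -expnD -expnM leq_exp2l //; lia.
case: n gn nmin n13 => // m gm nmin; rewrite ltnS => m13.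
have lt : ((32 * 32) ^ m < g)%N by rewrite ltnNge; apply/negP => /nmin; rewrite ltnn.
have := step _ gm; rewrite leqNgt => /negP[].
apply: leq_ltn_trans (_ : ((32 * 32) ^ m) ^ 3 < _)%N; last by rewrite ltn_exp2r.
by apply/ltnW/expn_gap; rewrite ?m13 //; vm_compute.
Qed.

(** * Ljunggren's equation *)

Local Open Scope nat_scope.

Lemma coprime_mul_sqr u v w : 0 < u -> coprime u v -> u * v = w ^ 2 -> u = gcdn u w ^ 2.
Proof.
move=> u0 uv uvw; set d := gcdn u w.
have d0 : 0 < d by rewrite gcdn_gt0 u0.
have /dvdnP[u' uE] : d %| u by apply: dvdn_gcdl.
have /dvdnP[w' wE] : d %| w by apply: dvdn_gcdr.
have cuw : coprime u' w'.
  rewrite /coprime -(eqn_pmul2r d0) mul1n muln_gcdl -uE -wE //.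
have e : u' * v = d * w' ^ 2.
  apply/eqP; rewrite -(eqn_pmul2l d0); apply/eqP.
  by rewrite mulnA [d * u']mulnC -uE uvw wE expnMn; ring.
have u'd : u' %| d by rewrite -(@Gauss_dvdl _ _ (w' ^ 2)) ?coprimeXr // -e dvdn_mulr.
have du' : d %| u'.
  rewrite -(@Gauss_dvdl _ _ v) ?e ?dvdn_mulr //.
  by apply: coprime_dvdl uv; exact: dvdn_gcdl.
have -> : d ^ 2 = d * d by rewrite -mulnn.
by rewrite {1}uE; congr (_ * _); apply/eqP; rewrite eqn_dvd u'd.
Qed.

(** The squares [n ^ 2] and [m ^ 2] are the coprime factors [(z - x) / 2] and [(z + x) / 2] of
    [y ^ 2]. *)
Lemma pythagorean_triple x y z : coprime x y.*2 -> odd x -> x ^ 2 + y.*2 ^ 2 = z ^ 2 ->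
  exists m n, [/\ x + n ^ 2 = m ^ 2, y = m * n, z = m ^ 2 + n ^ 2 & coprime m n].
Proof.
move=> cxy ox e.
have oz : odd z.
  have /(congr1 odd) := e; rewrite !oddD !oddX odd_double ox /=; by [].
have xz : x <= z by rewrite -leq_sqr -e leq_addr.
have [v zE] : exists v, z = x + v.*2.
  exists ((z - x)./2); have : ~~ odd (z - x) by rewrite oddB // oz ox.
  by move/even_halfK => ->; rewrite subnKC.
have vy : v * (v + x) = y ^ 2.
  move: e; rewrite zE -!muln2; clear; nia.
case: (posnP v) => [v0|v0].
  move: vy; rewrite v0 mul0n => /esym/eqP; rewrite expn_eq0 andbT => /eqP y0.
  move: cxy; rewrite y0 /coprime /= gcdn0 => /eqP x1.
  by exists 1, 0; rewrite zE v0 x1.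
have cvx : coprime v (v + x).
  have cxy2 : coprime x (y ^ 2).
    by apply: coprimeXr; apply: coprime_dvdr cxy; rewrite -muln2 dvdn_mulr.
  by rewrite /coprime gcdnDl -/(coprime v x) coprime_sym; apply: coprime_dvdr cxy2; rewrite -vy dvdn_mulr.
have vE := coprime_mul_sqr v0 cvx vy.
have v0' : 0 < v + x by rewrite addn_gt0 v0.
have := @coprime_mul_sqr (v + x) v y v0'; rewrite coprime_sym mulnC => /(_ cvx vy) vxE.
exists (gcdn (v + x) y), (gcdn v y).
rewrite -vE -vxE; split=> //.
- by rewrite addnC.
- by apply/eqP; rewrite -(@eqn_exp2r _ _ 2) // expnMn -vE -vxE mulnC vy.
- by rewrite zE; move: x v {xz zE vy v0 cvx vE v0' vxE ox e cxy}; lia.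
- apply: coprime_dvdl (dvdn_gcdl _ _) _; apply: coprime_dvdr (dvdn_gcdl _ _) _.
  by rewrite coprime_sym.
Qed.

(** Multiplication of [a + b * sqrt 2] by [3 + 2 * sqrt 2], the square of the fundamental unit. *)
Definition pell_step (p : nat * nat) := (3 * p.1 + 4 * p.2, 2 * p.1 + 3 * p.2).

(** Descent by the inverse step. For [b > 1] the inequalities below make its subtractions exact and
    its second coordinate smaller than [b]. *)
Lemma pell_solution a b : a ^ 2 + 1 = 2 * b ^ 2 -> exists n, (a, b) = iter n pell_step (1, 1).
Proof.
elim: b {-2}b (leqnn b) a => [|N IHN] b bN a e.
  by move: e bN; rewrite leqn0 => + /eqP b0; rewrite b0; clear; nia.
case: (leqP b 1) => b1.
  have b1' : b = 1 by move: e b1; clear; case: b => [|[|b]] //; nia.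
  exists 0; rewrite b1' /=; congr (_, _); move: e; rewrite b1'; clear; nia.
have ba : b < a by move: e b1; clear; nia.
have h1 : 4 * b <= 3 * a by move: e b1; clear; case: (leqP b 2) => ?; nia.
have h2 : 2 * a <= 3 * b by move: e; clear; nia.
have [||n nE] := IHN (3 * b - 2 * a) _ (3 * a - 4 * b).
- by move: bN ba h2; clear; lia.
- have [x xE] : exists x, 3 * a = 4 * b + x by exists (3 * a - 4 * b); rewrite subnKC.
  have [y yE] : exists y, 3 * b = 2 * a + y by exists (3 * b - 2 * a); rewrite subnKC.
  rewrite xE yE !addKn.
  have aE : a = 3 * x + 4 * y by move: xE yE; clear; lia.
  have bE : b = 2 * x + 3 * y by move: xE yE; clear; lia.
  move: e; rewrite aE bE; clear; nia.
exists n.+1; rewrite iterS -nE /pell_step /=; congr (_, _); move: h1 h2; clear; lia.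
Qed.

Lemma pell_iter_ge n : let p := iter n pell_step (1, 1) in 4 ^ n <= p.2 <= p.1.
Proof.
elim: n => //= n /andP[h1 h2]; rewrite /pell_step /= expnS.
by move: h1 h2; case: (iter _ _ _) => x y /=; move: (4 ^ n) => z; clear; lia.
Qed.

(** Binary numbers keep the check computable. A square second coordinate is accepted only with root
    1 or 13. *)
Fixpoint pell_nonsquare (n : nat) (a b : N) : bool :=
  let s := N.sqrt b in
  (~~ N.eqb (s * s) b || N.eqb s 1 || N.eqb s 13) &&
  if n is n'.+1 then pell_nonsquare n' (3 * a + 4 * b) (2 * a + 3 * b) else true.

Lemma pell_nonsquareP n k (a b : N) g : pell_nonsquare n a b -> k <= n ->
  (iter k pell_step (a : nat, b : nat)).2 = g ^ 2 -> g = 1 \/ g = 13.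
Proof.
have base (b' : N) : let s := N.sqrt b' in
    ~~ N.eqb (s * s) b' || N.eqb s 1 || N.eqb s 13 -> (b' : nat) = g ^ 2 -> g = 1 \/ g = 13.
  move=> s h bg; have bE : b' = N.mul (bin_of_nat g) (bin_of_nat g).
    by apply: (can_inj nat_of_binK); rewrite bg -{1}(bin_of_natK g) -mulnn; lia.
  have sE : s = bin_of_nat g by rewrite /s bE N.sqrt_square.
  rewrite -(bin_of_natK g) -sE.
  by move: h; rewrite {1 2}sE {1}bE N.eqb_refl /= => /orP[]/N.eqb_eq->; [left | right].
elim: n k a b => [|n IHn] [|k] a b //.
- by rewrite /= andbT => + _; apply: base.
- by case/andP => + _ _; apply: base.
case/andP=> _ h kn; rewrite iterSr => e; apply: IHn h kn _.
have -> : nat_of_bin (3 * a + 4 * b)%num = 3 * a + 4 * b by lia.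
by have -> : nat_of_bin (2 * a + 3 * b)%num = 2 * a + 3 * b by lia.
Qed.

(** The triple is parametrized by [m], [n], and [m ^ 2 + n ^ 2 = g ^ 2] again by [r], [s]. Then
    [x - 2 y = m ^ 2 - n ^ 2 - 2 m n] is the Thue form at [r], [- s] if [n] is even, and minus the
    form at [r], [s] if [m] is. *)
Lemma pythagorean_thue (x y g : nat) : coprime x y.*2 -> odd x ->
  x ^ 2 + y.*2 ^ 2 = (g ^ 2) ^ 2 -> ((x%:Z - (y.*2)%:Z) ^+ 2 = 1)%R ->
  exists r s : int, (r ^+ 2 + s ^+ 2 = g%:Z)%R /\ (thue_form r s ^+ 2 = 1)%R.
Proof.
move=> cxy ox e xy1; have [m [n [xE yE gE cmn]]] := pythagorean_triple cxy ox e.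
have XE : (x%:Z = m%:Z ^+ 2 - n%:Z ^+ 2)%R by move: xE; clear; lia.
have YE : ((y.*2)%:Z = 2 * m%:Z * n%:Z)%R by rewrite yE; clear; lia.
have : odd m (+) odd n.
  by move/(congr1 odd): xE; rewrite oddD !oddX ox /=; case: (odd m) (odd n) => [] [].
case om: (odd m) => /= on.
  have nE : n = n./2.*2 by rewrite even_halfK.
  rewrite nE in cmn gE; have [r [s [mE n2E gE' _]]] := pythagorean_triple cmn om (esym gE).
  exists r%:Z, (- s%:Z)%R; split; first by rewrite gE'; clear; lia.
  have ME : (m%:Z = r%:Z ^+ 2 - s%:Z ^+ 2)%R by move: mE; clear; lia.
  have NE : (n%:Z = 2 * r%:Z * s%:Z)%R by rewrite nE n2E; clear; lia.
  by rewrite -xy1 XE YE ME NE /thue_form; ring.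
have mE : m = m./2.*2 by rewrite even_halfK ?om.
rewrite coprime_sym mE in cmn; rewrite addnC mE in gE.
have [r [s [nE m2E gE' _]]] := pythagorean_triple cmn on (esym gE).
exists r%:Z, s%:Z; split; first by rewrite gE'; clear; lia.
have NE : (n%:Z = r%:Z ^+ 2 - s%:Z ^+ 2)%R by move: nE; clear; lia.
have ME : (m%:Z = 2 * r%:Z * s%:Z)%R by rewrite mE m2E; clear; lia.
by rewrite -xy1 XE YE ME NE /thue_form; ring.
Qed.

(** As [a = 2 q + 1] is odd, the equation says that the consecutive numbers [q] and [q + 1] are the
    legs of a Pythagorean triangle with hypotenuse [g ^ 2]. *)
Lemma ljunggren_thue a g : a ^ 2 + 1 = 2 * g ^ 4 ->
  exists r s : int, (r ^+ 2 + s ^+ 2 = g%:Z)%R /\ (thue_form r s ^+ 2 = 1)%R.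
Proof.
move=> e; have oa : odd a.
  by move/(congr1 odd): e; rewrite oddD oddX oddM /=; case: (odd a).
pose q := a./2; have aE : a = q.*2.+1 by rewrite -[LHS]odd_double_half oa.
have e' : q ^ 2 + q.+1 ^ 2 = (g ^ 2) ^ 2.
  by rewrite -expnM; move: e; rewrite aE; move: (g ^ (2 * 2)) => G; clear; nia.
have cq : coprime q q.+1 by exact: coprimenS.
case oq: (odd q).
  have qE : q.+1 = (q.+1)./2.*2 by rewrite even_halfK //= oq.
  apply: (@pythagorean_thue q (q.+1)./2) => //; rewrite -qE //.
  by clear; lia.
have qE : q = q./2.*2 by rewrite even_halfK ?oq.
apply: (@pythagorean_thue q.+1 q./2); rewrite -?qE //= ?oq // 1?coprime_sym 1?addnC //.
by clear; lia.
Qed.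

Lemma ljunggren a g : a ^ 2 + 1 = 2 * g ^ 4 -> g = 1 \/ g = 13.
Proof.
move=> e; have [r [s [gE F1]]] := ljunggren_thue e.
have g130 := thue_norm_le gE F1.
have [n nE] : exists n, (a, g ^ 2) = iter n pell_step (1, 1).
  by apply: pell_solution; rewrite e -expnM.
have /andP[n1 _] := pell_iter_ge n.
(* The second Pell coordinate is at least [4 ^ n], and here it is [g ^ 2 <= 2 ^ 260]. *)
have n130 : n <= 130.
  have : 2 ^ (2 * n) <= 2 ^ 260.
    rewrite (expnM 2 2); apply: leq_trans n1 _; rewrite -nE /=.
    by rewrite -[260]/(130 * 2) expnM leq_exp2r.
  by rewrite leq_exp2l //; clear; lia.
apply: (@pell_nonsquareP 130 n 1 1 g _ n130); first by vm_compute.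
by rewrite -nE.
Qed.

(** * The curve *)

Local Open Scope ring_scope.

Lemma sqr_eq_double (a b : int) : a ^+ 2 = 2 * b ^+ 2 -> a = 0 /\ b = 0.
Proof.
move=> e; have {}e : (`|a| ^ 2 = 2 * `|b| ^ 2)%N.
  by move/(congr1 absz): e; rewrite abszM !abszX.
suff b0 : `|b|%N = 0%N by move: e; rewrite b0; split; lia.
apply/eqP; rewrite -leqn0 leqNgt; apply/negP => b0.
have a0 : (0 < `|a|)%N by move: e b0; clear; case: (`|a|)%N => //; lia.
move/(congr1 (logn 2)): e; rewrite lognM ?expn_gt0 ?b0 // !lognX (_ : logn 2 2 = 1%N) //.
by move: (logn _ _) (logn _ _) => x y; clear; lia.
Qed.

(** Being odd and dividing both [2 c ^ 2 - d ^ 2] and [2 c ^ 2 + d ^ 2], [b] divides [c ^ 2] and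
    [d ^ 2], hence the square of their roots' gcd. Conversely that square divides [2 c ^ 2 - d ^ 2],
    which is [b] up to sign. *)
Lemma sqr_factor_norm (b c d : int) : odd `|b| -> b ^+ 2 = (2 * c ^+ 2 - d ^+ 2) ^+ 2 ->
  (b %| 2 * c ^+ 2 + d ^+ 2)%Z -> exists g : nat, `|b|%N = (g ^ 2)%N.
Proof.
move=> ob b2 bs; set B := 2 * c ^+ 2 - d ^+ 2 in b2.
have bB : (b %| B)%Z.
  by move/esym/eqP: b2; rewrite eqf_sqr => /orP[]/eqP->; rewrite ?rpredN dvdzz.
have co2 : coprimez b 2 by rewrite coprimezE coprimen2.
have co4 : coprimez b 4 by exact: (coprimezXr 2 co2).
have bc : (`|b| %| `|c| ^ 2)%N.
  rewrite -abszX -dvdzE -(Gauss_dvdzr _ co4).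
  have -> : 4 * c ^+ 2 = (2 * c ^+ 2 + d ^+ 2) + B by rewrite /B; ring.
  exact: rpredD.
have bd : (`|b| %| `|d| ^ 2)%N.
  rewrite -abszX -dvdzE -(Gauss_dvdzr _ co2).
  have -> : 2 * d ^+ 2 = (2 * c ^+ 2 + d ^+ 2) - B by rewrite /B; ring.
  exact: rpredB.
exists (gcdn `|c| `|d|); set g := gcdn _ _; apply/eqP; rewrite eqn_dvd; apply/andP; split.
  have b0 : (0 < `|b|)%N by case: (`|b|)%N ob.
  have g0 : (0 < g)%N.
    rewrite lt0n; apply/eqP => g0; have := dvdn_gcdl `|c| `|d|; have := dvdn_gcdr `|c| `|d|.
    rewrite -/g g0 !dvd0n => /eqP d0 /eqP c0; move: b2.
    have -> : B = 0 by rewrite /B; move: c0 d0; clear; nia.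
    by move=> /eqP; rewrite expr0n /= sqrf_eq0 => /eqP b00; rewrite b00 in b0.
  have /dvdnP[c1 cE] := dvdn_gcdl `|c| `|d|; have /dvdnP[d1 dE] := dvdn_gcdr `|c| `|d|.
  rewrite -/g in cE dE.
  have co : coprime (c1 ^ 2) (d1 ^ 2).
    rewrite coprimeXl // coprimeXr // /coprime -(eqn_pmul2r g0) mul1n muln_gcdl.
    by rewrite -cE -dE.
  have -> : (g ^ 2 = gcdn (`|c| ^ 2) (`|d| ^ 2))%N.
    by rewrite cE dE !expnMn -muln_gcdl (eqP co) mul1n.
  by rewrite dvdn_gcd bc.
have h1 : (g ^ 2 %| `|c| ^ 2)%N by rewrite dvdn_exp2r // dvdn_gcdl.
have h2 : (g ^ 2 %| `|d| ^ 2)%N by rewrite dvdn_exp2r // dvdn_gcdr.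
have gB : ((g ^ 2)%N%:Z %| B)%Z.
  by apply: rpredB; [apply: dvdz_mull|]; rewrite dvdzE abszX.
have -> : `|b|%N = `|B|%N by move/eqP: b2; rewrite eqf_sqr => /orP[]/eqP->; rewrite ?abszN.
by rewrite dvdzE in gB.
Qed.

(** The last two hypotheses are the coordinates of [(2 + sqrt 2) z ^ 2 = y ^ 2 + 1] for
    [y = a + b sqrt 2], [z = c + d sqrt 2]. If [N y = 1], then [y ^ 2 + 1 = 2 a y] and
    [(N z) ^ 2 = 2 a ^ 2], which is impossible. If [N y = -1], then [y ^ 2 + 1 = 2 b sqrt 2 y] and
    [(N z) ^ 2 = 4 b ^ 2]. *)
Lemma unit_square_ljunggren (a b c d : int) :
  a ^+ 2 - 2 * b ^+ 2 = 1 \/ a ^+ 2 - 2 * b ^+ 2 = -1 ->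
  2 * (c ^+ 2 + 2 * d ^+ 2) + 4 * c * d = a ^+ 2 + 2 * b ^+ 2 + 1 ->
  c ^+ 2 + 2 * d ^+ 2 + 4 * c * d = 2 * a * b ->
  exists2 g : nat, `|b|%N = (g ^ 2)%N & (`|a| ^ 2 + 1 = 2 * g ^ 4)%N.
Proof.
move=> [] n h1 h2.
  have [_ a0] : c ^+ 2 - 2 * d ^+ 2 = 0 /\ a = 0.
    apply: sqr_eq_double.
    have k : 2 * c * d = 2 * a * b - a ^+ 2 by move: n h1 h2; clear; lia.
    have m : c ^+ 2 + 2 * d ^+ 2 = 2 * a ^+ 2 - 2 * a * b by move: n h1 h2; clear; lia.
    have -> : (c ^+ 2 - 2 * d ^+ 2) ^+ 2 =
      (c ^+ 2 + 2 * d ^+ 2) ^+ 2 - 2 * (2 * c * d) ^+ 2 by ring.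
    rewrite k m; transitivity (2 * a ^+ 2 * (a ^+ 2 - 2 * b ^+ 2)); first by ring.
    by rewrite n mulr1.
  by move: n; rewrite a0; clear; nia.
have k : 2 * c * d = 2 * a * b - 2 * b ^+ 2 by move: n h1 h2; clear; lia.
have m : c ^+ 2 + 2 * d ^+ 2 = 4 * b ^+ 2 - 2 * a * b by move: n h1 h2; clear; lia.
have n2 : (c ^+ 2 - 2 * d ^+ 2) ^+ 2 = 4 * b ^+ 2.
  have -> : (c ^+ 2 - 2 * d ^+ 2) ^+ 2 =
    (c ^+ 2 + 2 * d ^+ 2) ^+ 2 - 2 * (2 * c * d) ^+ 2 by ring.
  rewrite k m; transitivity (- 4 * b ^+ 2 * (a ^+ 2 - 2 * b ^+ 2)); first by ring.
  by rewrite n; ring.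
have parity (x : int) : exists y, x = 2 * y \/ x = 2 * y + 1.
  by exists (x %/ 2)%Z; clear; lia.
have [c' cE] : exists c', c = 2 * c'.
  have [c' [cE|cE]] := parity c; first by exists c'.
  have : (c ^+ 2 - 2 * d ^+ 2) ^+ 2 = (2 * b) ^+ 2 by rewrite n2; ring.
  by move/eqP; rewrite eqf_sqr cE => /orP[]/eqP; clear; lia.
rewrite cE in k m n2.
have ob : odd `|b|.
  have [b' [bE|bE]] := parity b; last by rewrite bE; clear; lia.
  by have [a' [aE|aE]] := parity a; move: n; rewrite aE bE; clear; lia.
have b2 : b ^+ 2 = (2 * c' ^+ 2 - d ^+ 2) ^+ 2 by move: n2; clear; lia.
have bs : (b %| 2 * c' ^+ 2 + d ^+ 2)%Z.
  have -> : 2 * c' ^+ 2 + d ^+ 2 = (2 * b - a) * b by move: m; clear; lia.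
  exact: dvdz_mull.
have [g bg] := sqr_factor_norm ob b2 bs.
exists g => //; rewrite (expnM g 2 2) -bg; move: n; clear; lia.
Qed.

(** * Integer coordinates and the points of the curve *)

Definition zsqrt2 (p : int * int) : algC := p.1%:~R + p.2%:~R * sqrtC 2.

Lemma sqrtC2_sqr : sqrtC 2 ^+ 2 = 2 :> algC.
Proof. exact: sqrtCK. Qed.

Lemma zsqrt2_inj : injective zsqrt2.
Proof.
move=> [a b] [c d]; rewrite /zsqrt2 /= => e.
have : (a - c)%:~R = (d - b)%:~R * sqrtC 2 :> algC.
  by rewrite !rmorphB /= -[a%:~R](addrK (b%:~R * sqrtC 2)) e; ring.
move/(congr1 (fun x => x ^+ 2)); rewrite exprMn sqrtC2_sqr mulrC -[2]/(2%:~R) -!rmorphXn -rmorphM.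
move/intr_inj/sqr_eq_double => [ac db].
by move: ac db => /eqP; rewrite subr_eq0 => /eqP-> /eqP; rewrite subr_eq0 => /eqP->.
Qed.

(** Multiplied by [y], the first equation involves only [y ^+ 2], [y * x3 = z - 1] and
    [x1 * y = s * z - 1], where [z = y * x3 + 1]. *)
Lemma solution_norm_eq (s x1 y x3 : algC) : y - x1 * y * x3 - x1 - x3 = 0 ->
  x1 * y + 1 = s * (y * x3 + 1) -> s * (y * x3 + 1) ^+ 2 = y ^+ 2 + 1.
Proof.
move=> e1 e2.
have e3 : x1 * y = s * (y * x3 + 1) - 1 by rewrite -e2 addrK.
have -> : y ^+ 2 + 1 = y * (y - x1 * y * x3 - x1 - x3) + x1 * y * (y * x3 + 1) + (y * x3 + 1).
  by ring.
by rewrite e1 mulr0 e3; ring.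
Qed.

(* The second equation reads [y * (x1 - s * x3) = s - 1], so that [y] is a unit. *)
Lemma solution_coord2 (p1 p p3 : int * int) : let w := sqrtC 2 : algC in
  let: (x1, y, x3) := (zsqrt2 p1, zsqrt2 p, zsqrt2 p3) in
  y - x1 * y * x3 - x1 - x3 = 0 -> x1 * y + 1 = (2 + w) * (y * x3 + 1) ->
  (p.1 ^+ 2 = 1 /\ p.2 ^+ 2 = 1) \/ (p.1 ^+ 2 = 239 ^+ 2 /\ p.2 ^+ 2 = 169 ^+ 2).
Proof.
case: p1 p p3 => [x1 x1'] [a b] [x3 x3'] /=; set w := sqrtC 2 => e1 e2.
have w2 : w ^+ 2 = 2 by exact: sqrtC2_sqr.
pose c := a * x3 + 2 * b * x3' + 1; pose d := a * x3' + b * x3.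
have zE : zsqrt2 (a, b) * zsqrt2 (x3, x3') + 1 = zsqrt2 (c, d).
  rewrite /zsqrt2 /c /d /= !(intrD, intrM) -/w; ring: w2.
have := solution_norm_eq e1 e2; rewrite zE.
have -> : (2 + w) * zsqrt2 (c, d) ^+ 2 =
    zsqrt2 (2 * (c ^+ 2 + 2 * d ^+ 2) + 4 * c * d, c ^+ 2 + 2 * d ^+ 2 + 4 * c * d).
  rewrite /zsqrt2 /= !(intrD, intrM, rmorphXn) /= -/w; ring: w2.
have -> : zsqrt2 (a, b) ^+ 2 + 1 = zsqrt2 (a ^+ 2 + 2 * b ^+ 2 + 1, 2 * a * b).
  rewrite /zsqrt2 /= !(intrD, intrM, rmorphXn) /= -/w; ring: w2.
move/zsqrt2_inj => [h1 h2].
(* With [s = 2 + w], [p + q * w] is [x1 - s * x3]. Its product with [w - 1], the inverse of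
   [s - 1 = 1 + w], is the inverse of [y]. *)
pose p := x1 - 2 * x3 - 2 * x3'; pose q := x1' - x3 - 2 * x3'.
have yt : zsqrt2 (a, b) * zsqrt2 (2 * q - p, p - q) = zsqrt2 (1, 0).
  have -> : zsqrt2 (2 * q - p, p - q) = (zsqrt2 (x1, x1') - (2 + w) * zsqrt2 (x3, x3')) * (w - 1).
    rewrite /zsqrt2 /p /q /= !(intrB, intrM) -/w; ring: w2.
  have e3 : zsqrt2 (a, b) * (zsqrt2 (x1, x1') - (2 + w) * zsqrt2 (x3, x3')) = 1 + w.
    have -> : 1 + w = (2 + w) * (zsqrt2 (a, b) * zsqrt2 (x3, x3') + 1) - 1
      - (2 + w) * (zsqrt2 (a, b) * zsqrt2 (x3, x3')) by ring.
    by rewrite -e2; ring.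
  by rewrite mulrA e3 /zsqrt2 /= mul0r addr0; ring: w2.
have n1 : a ^+ 2 - 2 * b ^+ 2 = 1 \/ a ^+ 2 - 2 * b ^+ 2 = -1.
  move: (2 * q - p) (p - q) yt => t t'.
  have -> : zsqrt2 (a, b) * zsqrt2 (t, t') = zsqrt2 (a * t + 2 * b * t', a * t' + b * t).
    rewrite /zsqrt2 /= !(intrD, intrM) -/w; ring: w2.
  move/zsqrt2_inj => [u1 u2].
  have : (a ^+ 2 - 2 * b ^+ 2) * (t ^+ 2 - 2 * t' ^+ 2) = 1.
    transitivity ((a * t + 2 * b * t') ^+ 2 - 2 * (a * t' + b * t) ^+ 2); first by ring.
    by rewrite u1 u2.
  move: (a ^+ 2 - _) (t ^+ 2 - _) => m n /(congr1 absz); rewrite abszM => /eqP.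
  by rewrite muln_eq1 => /andP[/eqP + _]; clear; lia.
have [g bg ag] := unit_square_ljunggren n1 h1 h2.
have sqE (x : int) : x ^+ 2 = (`|x| ^ 2)%N%:Z by rewrite -abszX gez0_abs ?sqr_ge0.
have := ljunggren ag; move: ag; rewrite !sqE bg; move: (`|a| ^ 2)%N => A + [] gE;
  rewrite gE => AE; [left | right]; split=> //; lia.
Qed.

(** The value of [y] determines [z = y * x3 + 1] up to sign, and [z] determines [x1] and [x3]. Two
    known points with opposite [z] therefore exhaust the fiber. *)
Lemma solution_fiber (s y x1 x3 u1 u3 v1 v3 : algC) : s != 0 -> y != 0 ->
  y - x1 * y * x3 - x1 - x3 = 0 /\ x1 * y + 1 = s * (y * x3 + 1) ->
  y - u1 * y * u3 - u1 - u3 = 0 /\ u1 * y + 1 = s * (y * u3 + 1) ->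
  y - v1 * y * v3 - v1 - v3 = 0 /\ v1 * y + 1 = s * (y * v3 + 1) ->
  y * v3 + 1 = - (y * u3 + 1) ->
  (x1, y, x3) = (u1, y, u3) \/ (x1, y, x3) = (v1, y, v3).
Proof.
move=> s0 y0 [x x'] [u u'] [v v'] uv.
have same a1 a3 : a1 * y + 1 = s * (y * a3 + 1) -> y * x3 + 1 = y * a3 + 1 ->
    (x1, y, x3) = (a1, y, a3).
  move=> a' e; have e3 : x3 = a3 by apply: (mulfI y0); apply: (addIr 1).
  have e1 : x1 = a1 by apply: (mulIf y0); apply: (addIr 1); rewrite x' a' e.
  by rewrite e1 e3.
have /(mulfI s0)/eqP := etrans (solution_norm_eq x x') (esym (solution_norm_eq u u')).
by rewrite eqf_sqr => /orP[]/eqP e; [left; apply: same | right; apply: same; rewrite // uv].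
Qed.

Definition zsqrt2_triple (p : (int * int) * (int * int) * (int * int)) : algC * algC * algC :=
  (zsqrt2 p.1.1, zsqrt2 p.1.2, zsqrt2 p.2).

Lemma zsqrt2_triple_inj : injective zsqrt2_triple.
Proof. by move=> [[a b] c] [[a' b'] c'] [/zsqrt2_inj-> /zsqrt2_inj-> /zsqrt2_inj->]. Qed.

Lemma zsqrt2_tripleN p : zsqrt2_triple (- p) = - zsqrt2_triple p.
Proof.
case: p => [[[a b] [c d]] [e f]]; rewrite /zsqrt2_triple /zsqrt2 /=.
by congr (_, _, _); rewrite !rmorphN /= mulNr opprD.
Qed.

Definition base_solutions : seq ((int * int) * (int * int) * (int * int)) :=
  [:: ((3, -1), (1, 1), (3, -2));
      ((1, 1), (-1, -1), (1, 0));
      ((1, 1), (-1, 1), (-1, 0));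
      ((3, 3), (1, -1), (1, 2));
      ((57, -39), (239, 169), (-73, 52));
      ((-421, 299), (-239, -169), (-551, 390));
      ((203, 143), (-239, 169), (-109, -78));
      ((681, 481), (239, -169), (369, 260))].

Theorem theorem6p7 :
  let w : algC := sqrtC 2 in
  let u : algC := 1 + w in
  let triples : seq (algC * algC * algC) :=
    [:: (3 - w, 1 + w, 3 - 2 * w);
        (1 + w, -1 - w, 1);
        (1 + w, -1 + w, -1);
        (3 + 3 * w, 1 - w, 1 + 2 * w);
        (57 - 39 * w, 239 + 169 * w, -73 + 52 * w);
        (-421 + 299 * w, -239 - 169 * w, -551 + 390 * w);
        (203 + 143 * w, -239 + 169 * w, -109 - 78 * w);
        (681 + 481 * w, 239 - 169 * w, 369 + 260 * w)] in
  let points := triples ++ [seq - P | P <- triples] in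
  [/\ size points = 16%N,
      uniq points,
      forall P : algC * algC * algC,
        Zsqrt2_triple P /\ pcf_variety03 1 0 (- (2 + w)) P <-> P \in points &
      [seq P.1.2 | P <- triples] =
        [:: u; - u; u^-1; - u^-1; u ^+ 7; - u ^+ 7; u ^- 7; - u ^- 7]].
Proof.
move=> w u triples points; have w2 : w ^+ 2 = 2 by exact: sqrtC2_sqr.
have triplesE : triples = map zsqrt2_triple base_solutions.
  rewrite /triples /zsqrt2_triple /zsqrt2 /= -/w.
  by do ![congr cons]; congr (_, _, _); ring.
have pointsE : points = map zsqrt2_triple (base_solutions ++ [seq - p | p <- base_solutions]).
  rewrite /points triplesE map_cat -!map_comp; congr (_ ++ _).
  by apply: eq_map => p /=; rewrite zsqrt2_tripleN.
pose sol (P : algC * algC * algC) := let: (x1, y, x3) := P in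
  y - x1 * y * x3 - x1 - x3 = 0 /\ x1 * y + 1 = (2 + w) * (y * x3 + 1).
have solT P : P \in triples -> sol P.
  rewrite !inE; do 7?[case/predU1P=> [->|]]; last move/eqP->; split; ring: w2.
have solN P : sol P -> sol (- P).
  case: P => [[x1 y] x3] [e1 e2].
  have -> : - (x1, y, x3) = (- x1, - y, - x3) :> algC * algC * algC by [].
  split; last by rewrite !mulrNN.
  by rewrite -[RHS]oppr0 -e1 /=; ring.
have solP P : P \in points -> sol P.
  by rewrite mem_cat => /orP[/solT //|/mapP[Q /solT/solN + ->]].
split.
- by [].
(* The points are injective images of integer tuples, on which distinctness is computed. *)
- by rewrite pointsE (map_inj_uniq zsqrt2_triple_inj); vm_compute.
- move=> P; split=> [[[]] | PP]; last first.
    have := PP; rewrite pointsE => /mapP[p _ PE]; split; last first.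
      by move: (solP P PP); case: P {PP PE} => [[x1 y] x3]; rewrite pcf_variety03E.
    by rewrite PE; split; eexists; eexists; reflexivity.
  case: P => [[x1 y] x3] /= E1 E2 E3 /pcf_variety03E; rewrite -/w => sP.
  case: E1 E2 E3 => [a1 [b1 x1E]] [a [b yE]] [a3 [b3 x3E]].
  have wN1 : w != -1.
    by apply/eqP => wE; move/eqP: w2; rewrite wE sqrrN expr1n -[1]/(1%:R) eqr_nat.
  have s0 : 2 + w != 0.
    apply/eqP => /eqP; rewrite addrC addr_eq0 => /eqP wE; move/eqP: w2.
    by rewrite wE sqrrN -natrX eqr_nat.
  have y0 : y != 0.
    apply/eqP => y0; move: sP => [_]; rewrite y0 mulr0 mul0r !add0r mulr1 => e.
    by case/eqP: wN1; rewrite -[w](addKr 2) -e; ring.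
  have fib x x' v v' : (x, y, x') \in points -> (v, y, v') \in points ->
      y * v' + 1 = - (y * x' + 1) -> (x1, y, x3) \in points.
    move=> xP vP xv.
    by case: (solution_fiber s0 y0 sP (solP _ xP) (solP _ vP) xv) => ->.
  have : (a ^+ 2 = 1 ^+ 2 /\ b ^+ 2 = 1 ^+ 2) \/ (a ^+ 2 = 239 ^+ 2 /\ b ^+ 2 = 169 ^+ 2).
    apply: (@solution_coord2 (a1, b1) (a, b) (a3, b3)); rewrite /zsqrt2 /= -/w -x1E -yE -x3E.
      exact: sP.1.
    exact: sP.2.
  have in1 x : x \in triples -> x \in points by rewrite mem_cat => ->.
  have in2 x : x \in triples -> - x \in points.
    by move=> h; rewrite mem_cat; apply/orP; right; apply/mapP; exists x.
  have nth1 k : (k < 8)%N -> nth 0 triples k \in points by move=> h; apply/in1/mem_nth.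
  have nth2 k : (k < 8)%N -> - nth 0 triples k \in points by move=> h; apply/in2/mem_nth.
  (* For each of the eight values of [y], the fiber consists of triple [k] and the negative of
     triple [k'], whose [z] are opposite. *)
  have pair k k' : (k < 8)%N -> (k' < 8)%N -> y = (nth 0 triples k).1.2 ->
     y = - (nth 0 triples k').1.2 ->
     - (y * (nth 0 triples k').2) + 1 = - (y * (nth 0 triples k).2 + 1) -> (x1, y, x3) \in points.
    move=> kl kl' y1 y2 e; have := nth1 _ kl; have := nth2 _ kl'; move: y1 y2 e.
    case: (nth 0 triples k) (nth 0 triples k') => [[p1 p2] p3] [[q1 q2] q3] /= y1 y2 e.
    rewrite -y1 (_ : - (q1, q2, q3) = (- q1, y, - q3)) => [h1 h2|]; last by rewrite y2.
    by apply: fib h2 h1 _; rewrite mulrN e.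
  case=> -[/eqP + /eqP]; rewrite !eqf_sqr => /orP[]/eqP aE /orP[]/eqP bE; move: yE; rewrite aE bE -/w => yE.
  - by apply: (pair 0%N 1%N); rewrite // yE /=; ring: w2.
  - by apply: (pair 3%N 2%N); rewrite // yE /=; ring: w2.
  - by apply: (pair 2%N 3%N); rewrite // yE /=; ring: w2.
  - by apply: (pair 1%N 0%N); rewrite // yE /=; ring: w2.
  - by apply: (pair 4%N 5%N); rewrite // yE /=; ring: w2.
  - by apply: (pair 7%N 6%N); rewrite // yE /=; ring: w2.
  - by apply: (pair 6%N 7%N); rewrite // yE /=; ring: w2.
  by apply: (pair 5%N 4%N); rewrite // yE /=; ring: w2.
- have uw : u * (w - 1) = 1 by rewrite /u; ring: w2.
  have u0 : u != 0 by apply/eqP => u0; move/eqP: uw; rewrite u0 mul0r eq_sym oner_eq0.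
  have uV : u^-1 = w - 1 by apply: (mulfI u0); rewrite divff.
  by rewrite -exprVn uV /triples /u /=; do ![congr cons]; ring: w2.
Qed.
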